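(* Let $A\in\mathbb{R}^{n\times n}$, $b\in\mathbb{R}^{n}$, $c\in\mathbb{R}^{1\times n}$, let $g$ be the impulse response of the system $(A,b,c)$, let $\mathcal{H}_g$ be its Hankel operator, and let $1\le k\le n$. Then the following are equivalent: 1. $\mathcal{H}_g$ is strictly $(k-1)$-variation bounding. 2. $\mathcal{H}_g$ is strictly $k$-sign consistent. 3. For every $r\in\{1,\dots,k\}$, the generalized compound system $$\left(A_{[r]},\; (A_{[r]})^{k-r}\,\big(\mathcal{C}^{r}(A,b)\big)_{[r]},\; \varepsilon\,\big(\mathcal{O}^{k}(A,c)\big)_{[k]}\,F^{\mathcal{C}^{k-r}(A,b),k}\right)$$ is strictly externally positive, where $\varepsilon:=\operatorname{sign}\big(\det H_g(1,k,k)\big)$.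
   Context: Systems. A triple $(A,b,c)$ with $A\in\mathbb{R}^{n\times n}$, $b\in\mathbb{R}^n$, $c\in\mathbb{R}^{1\times n}$ denotes the discrete-time linear system $x(t+1)=Ax(t)+bu(t)$, $y(t)=cx(t)$. Its impulse response is $g(t)=cA^{t-1}b$ for $t\ge1$ and $g(t)=0$ for $t\le 0$. The system is (strictly) externally positive if $g(t)\ge0$ (resp. $g(t)>0$) for all $t\ge1$. Operators. $\mathcal{C}^N(A,b)=[\,b\;\;Ab\;\cdots\;A^{N-1}b\,]$, and $\mathcal{O}^N(A,c)$ is the matrix with rows $c,cA,\dots,cA^{N-1}$ (empty matrices for $N=0$). For $t\ge1$, $H_g(t,i,j)$ is the $i\times j$ matrix with $(p,q)$ entry $g(t+p+q-2)$. The Hankel operator is $(\mathcal{H}_g u)(t)=\sum_{\tau=1}^{\infty}g(t+\tau)u(-\tau)$, $t\ge0$, acting on real sequences $(u(-\tau))_{\tau\ge1}$ for which these sums converge; it is the limit for $N\to\infty$ of the truncations $(u(-1),\dots,u(-N))\mapsto H_g(1,N,N)(u(-1),\dots,u(-N))^{\mathsf T}$. Variation. For a real vector or sequence $u$, $S^-(u)$ is the number of sign changes in $u$ after deleting all zero entries, with $S^-(0):=-1$; $S^+(u)$ is the maximal number of sign changes obtainable by replacing each zero entry of $u$ by some real number. A linear map $X$ is (strictly) $k$-variation bounding if for all $u\ne0$ with $S^-(u)\le k$ one has $S^-(Xu)\le k$ (resp. $S^+(Xu)\le k$). Compounds and sign consistency. $\mathcal{I}_{n,r}$ is the set of $r$-element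 subsets of $\{1,\dots,n\}$, written as increasing tuples and ordered lexicographically. For $X\in\mathbb{R}^{n\times m}$, $X_{I,J}$ is the submatrix with rows $I$ and columns $J$, and the $r$-th multiplicative compound $X_{[r]}\in\mathbb{R}^{\binom nr\times\binom mr}$ has $(i,j)$ entry $\det X_{I,J}$, where $I,J$ are the $i$-th and $j$-th elements of $\mathcal{I}_{n,r}$ and $\mathcal{I}_{m,r}$. $X$ is (strictly) $k$-sign consistent if there is $\delta\in\{-1,1\}$ such that all entries of $\delta X_{[k]}$ are $\ge0$ (resp. $>0$). $\mathcal{H}_g$ is (strictly) $k$-sign consistent if and only if $H_g(1,N,N)$ is (strictly) $k$-sign consistent for all $N\ge k$. The matrix $F^{Y,m}$. For $1\le r\le m\le n$ and $Y\in\mathbb{R}^{n\times(m-r)}$, $F^{Y,m}\in\mathbb{R}^{\binom nm\times\binom nr}$ is defined as follows: if $r=m$, $F^{Y,m}$ is the identity matrix of size $\binom nm$; if $r<m$, with $I$ the $i$-th element of $\mathcal{I}_{n,m}$ and $J$ the $j$-th element of $\mathcal{I}_{n,r}$, $F^{Y,m}_{i,j}=(-1)^{\varepsilon(I\setminus J,I)}\det Y_{I\setminus J,\{1,\dots,m-r\}}$ if $J\subset I$ and $F^{Y,m}_{i,j}=0$ otherwise, where $\varepsilon(I\setminus J,I)=\sum_{s\in I\setminus J}\mathrm{pos}_I(s)+\frac{(m-r)(m-r+1)}{2}$ and $\mathrm{pos}_I(s)=l$ if $s$ is the $l$-th smallest element of $I$. *)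

(* Defs.v *)
From HB Require Import structures.
From mathcomp Require Export all_boot all_order all_algebra.
From mathcomp Require Export all_classical all_reals all_analysis.

Set Implicit Arguments.
Unset Strict Implicit.
Unset Printing Implicit Defensive.

Export Order.TTheory GRing.Theory Num.Theory numFieldNormedType.Exports.

#[export] Set Implicit Arguments.
#[export] Unset Strict Implicit.
#[export] Unset Printing Implicit Defensive.

Local Open Scope classical_set_scope.
Local Open Scope ring_scope.

Section Systems.
Context {R : realType}.
Implicit Types (n N k r t : nat) (g : nat -> R).

(* Only nonnegative times are represented; [g 0 = 0]. *)
Definition impulse_response n (A : 'M[R]_n) (b : 'cV[R]_n) (c : 'rV[R]_n)
    (t : nat) : R :=
  if t is t'.+1 then (c *m A ^+ t' *m b) 0 0 else 0.

Definition strictly_externally_positive n (A : 'M[R]_n) (b : 'cV[R]_n)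
    (c : 'rV[R]_n) : Prop :=
  forall t, (1 <= t)%N -> 0 < impulse_response A b c t.

Definition ctrl_mx N n (A : 'M[R]_n) (b : 'cV[R]_n) : 'M[R]_(n, N) :=
  \matrix_(i < n, j < N) (A ^+ j *m b) i 0.

Definition obs_mx N n (A : 'M[R]_n) (c : 'rV[R]_n) : 'M[R]_(N, n) :=
  \matrix_(i < N, j < n) (c *m A ^+ i) 0 j.

(* Rows and columns are numbered from 0, whence no "- 2" in the index. *)
Definition hankel_mx g t i j : 'M[R]_(i, j) :=
  \matrix_(p < i, q < j) g (t + p + q)%N.

(* An input is stored as a sequence [u : nat -> R] whose term [u j] is the
   value at time -(j+1): the j-th summand is g(t + (j+1)) u(-(j+1)). *)
Definition hankel_series g (u : nat -> R) t : nat -> R :=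
  series (fun j => g (t + j.+1)%N * u j).

Definition hankel_dom g : set (nat -> R) :=
  [set u | forall t, cvgn (hankel_series g u t)].

Definition hankel_op g (u : nat -> R) : nat -> R :=
  fun t => limn (hankel_series g u t).

End Systems.

Section Variation.
Context {R : realType}.
Implicit Types u v : nat -> R.

(* The pairs of positions of entries that become adjacent once the zero
   entries are deleted and that have opposite signs. *)
Definition sign_changes u : set (nat * nat) :=
  [set ij | [/\ (ij.1 < ij.2)%N,
                forall l, (ij.1 < l < ij.2)%N -> u l = 0
              & u ij.1 * u ij.2 < 0]].

(* Extended-real valued, since a sequence may change sign infinitely often. *)
Definition Sminus u : \bar R :=
  if u == cst 0 then (-1)%:E else counting (sign_changes u).

Definition Splus u : \bar R :=
  ereal_sup [set Sminus v | v in [set v | forall i, u i != 0 -> v i = u i]].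

Definition strictly_variation_bounding (k : nat) (D : set (nat -> R))
    (X : (nat -> R) -> (nat -> R)) : Prop :=
  forall u, D u -> u <> cst 0 ->
    (Sminus u <= k%:R%:E)%E -> (Splus (X u) <= k%:R%:E)%E.

End Variation.

Section Compounds.
Context {R : realType}.

Definition incr_tuples (n r : nat) : {set r.-tuplelexi 'I_n} :=
  [set I : r.-tuple 'I_n | sorted ltn (map val I)]%SET.

Lemma card_incr_tuples n r : #|incr_tuples n r| = 'C(n, r).
Proof. exact: card_ltn_sorted_tuples. Qed.

(* [Order.enum_val] lists a set along the order of its type, here the
   lexicographic order of [r.-tuplelexi 'I_n]. *)
Definition index_tuple n r (i : 'I_('C(n, r))) : r.-tuple 'I_n :=
  Order.enum_val (cast_ord (esym (card_incr_tuples n r)) i).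

Definition compound r n m (X : 'M[R]_(n, m)) : 'M[R]_('C(n, r), 'C(m, r)) :=
  \matrix_(i, j) \det (mxsub (tnth (index_tuple i)) (tnth (index_tuple j)) X).

Definition strictly_sign_consistent k n m (X : 'M[R]_(n, m)) : Prop :=
  exists2 delta : R, delta \in [:: -1; 1] &
    forall i j, 0 < (delta *: compound k X) i j.

Definition hankel_op_strictly_sign_consistent k (g : nat -> R) : Prop :=
  forall N, (k <= N)%N -> strictly_sign_consistent k (hankel_mx g 1 N N).

Definition rows_of n m (s : seq 'I_n) (Y : 'M[R]_(n, m)) : 'M[R]_m :=
  \matrix_(p, q) [seq Y i q | i <- s]`_p.

(* Coefficients of the Laplace expansion of the minors of [Y Z] along the
   columns of Y: up to a cast, compound m [Y Z] = laplace_mx Y *m compound r Z.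
   [I] is sorted, so [index s I] is one less than the rank of [s] in [I], and
   [D] lists the elements of the difference in increasing order; [D] has
   exactly m - r elements when [J] is a subset of [I]. *)
Definition laplace_coef n m r (Y : 'M[R]_(n, m - r)) (I : m.-tuple 'I_n)
    (J : r.-tuple 'I_n) : R :=
  if all (mem I) J then
    let D := [seq s <- I | s \notin J] in
    let eps := (\sum_(s <- D) (index s I).+1
                + ((m - r) * (m - r).+1) %/ 2)%N in
    (-1) ^+ eps * \det (rows_of D Y)
  else 0.

Definition laplace_mx n m r (Y : 'M[R]_(n, m - r)) :
    'M[R]_('C(n, m), 'C(n, r)) :=
  \matrix_(i, j)
    if r == m then (i == j :> nat)%:R
    else laplace_coef Y (index_tuple i) (index_tuple j).

Definition compound_sys_b n (A : 'M[R]_n) (b : 'cV[R]_n) k r :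
    'cV[R]_('C(n, r)) :=
  compound r A ^+ (k - r) *m
    castmx (erefl, binn r) (compound r (ctrl_mx r A b)).

Definition compound_sys_c n (A : 'M[R]_n) (b : 'cV[R]_n) (c : 'rV[R]_n) k r :
    'rV[R]_('C(n, r)) :=
  let eps := Num.sg (\det (hankel_mx (impulse_response A b c) 1 k k)) in
  eps *: (castmx (binn k, erefl) (compound k (obs_mx k A c))
            *m laplace_mx (ctrl_mx (k - r) A b)).

End Compounds.

(* Main.v *)
Require Import Defs.
From mathcomp Require Import all_fingroup finmap zify ring lra.

Set Implicit Arguments.
Unset Strict Implicit.
Unset Printing Implicit Defensive.

Local Open Scope ring_scope.

(** Put [s t = c A^t b], so that the Hankel operator has the entry [s (i + j)]
    in row [i] and column [j]; [hminor s k f h] is its [k]-minor with rows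
    [f 0 < ... < f (k-1)] and columns [h 0 < ... < h (k-1)].  Strict
    [k]-sign consistency says that all these minors have the sign of the
    leading one ([hankel_op_strictly_sign_consistentP]).

    Compound systems.  By the Cauchy-Binet formula and the Laplace expansion,
    the response of the [r]-th compound system at time [t + 1] is, up to the
    sign of the leading minor, the minor on the rows [0 .. k-1] and the columns
    [0 .. k-r-1, k-r+t .. k-1+t] ([compound_sys_response]).  So the third
    condition is about very few minors, and the point is that they control
    all the others.  For the minors on the rows [0 .. k-1] this is a positivity
    test for maximal minors: three-term Pluecker relations
    reach every set of columns ([vdet_gt0_of_shift_from]).

    For arbitrary rows ([hminor_gt0_of_first_rows]) one argues by induction on
    [k].  The ratios of certain minors are monotone, again by a Pluecker
    relation, so the normalized windows [(s j, ..., s (j+k-1))] converge when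
    [j] tends to infinity.  Since [s] satisfies a linear recurrence, the limit
    is a geometric vector [(1, l, ..., l^(k-1))] with [l > 0]
    ([anchor_exists]).  Replacing [s t] by [s t / l^t] turns it into the
    all-one vector, which then serves as one more column, at infinity.  A
    [k]-minor that contains this column is, up to a sign, a positive sum of
    [(k-1)]-minors of the difference sequence [s (t+1) - s t], which have
    constant sign by induction.  On the other hand a minor with arbitrary rows
    and consecutive columns is, by the symmetry of Hankel matrices, a minor
    with consecutive rows, whose sign is known.  Pluecker relations that
    involve the column at infinity lead from consecutive columns to all
    columns ([vdet_gt0_of_anchor]).  Passing to the limit makes weak those
    inequalities that involve column [0]; the induction hypothesis is applied
    to a perturbation of the difference sequence for which they are strict
    ([hminor_smooth]).

    Variation.  Up to zero entries, bounds on [Sminus] and [Splus] forbid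
    strict and weak alternations of signs along [k + 1] positions ([Sminus_le],
    [Splus_le]).  If all [k]-minors have the same sign, cut an input with fewer
    than [k] sign changes into [k] intervals on which its sign is constant
    ([sign_blocks]).  The output is a combination of [k] vectors, each a
    positive, possibly infinite, combination of columns of the operator, so by
    multilinearity the [k]-minors of these vectors still have constant sign;
    the linear dependence between [k + 1] vectors of a space of dimension [k]
    excludes a weak alternation ([no_weak_alternation]).  Conversely, inputs
    supported on [k] positions show that no [k]-minor vanishes
    ([minor_neq0]), and that moving one row index past no other one does not
    change the sign of a minor ([minor_adjacent]); such moves connect
    all sets of rows. *)

(** * Determinants of sequences of vectors *)

(** Vectors are functions on [nat] of which only the first [k] values count, and
    families of vectors are indexed by [nat]: choosing, deleting and inserting
    vectors is then composition with functions [nat -> nat], without casts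
    between matrix sizes. *)
Definition vdet (R : comNzRingType) (k : nat) (v : nat -> nat -> R) : R :=
  \det (\matrix_(i < k, j < k) v i j).

Definition cons_vec (T : Type) (x : T) (v : nat -> T) (i : nat) : T :=
  if i is i'.+1 then v i' else x.

Definition append_vec (T : Type) (x : nat -> T) m e : nat -> T :=
  fun j => if (j < m)%N then x j else e.

Lemma bumpE i j : bump i j = if (i <= j)%N then j.+1 else j.
Proof. by rewrite /bump; case: leqP. Qed.

Lemma bump_cases i j :
  ((i <= j)%N /\ bump i j = j.+1) \/ ((j < i)%N /\ bump i j = j).
Proof. by rewrite bumpE; case: leqP; [left | right]. Qed.

(** Deleting the [i]-th vector of a family is composition with [bump i], so that
    most index computations below are identities between nested [bump]s. *)
Ltac bump_lia :=
  first [ exfalso; lia |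
    lazymatch goal with
    | |- context [bump _ _] =>
      match goal with |- context [bump ?i ?j] =>
        lazymatch j with
        | context [bump _ _] => fail
        | _ => case: (bump_cases i j) => -[? ->]
        end
      end; bump_lia
    | _ => lia
    end ].

Section Det.
Variable R : comNzRingType.
Implicit Types (k : nat) (v w : nat -> nat -> R) (x y z : nat -> R).

Lemma eq_vdet k v w : (forall i j, (i < k)%N -> (j < k)%N -> v i j = w i j) ->
  vdet k v = vdet k w.
Proof. by move=> e; congr (\det _); apply/matrixP => i j; rewrite !mxE e. Qed.

Lemma vdet_tr k v : vdet k (fun i j => v j i) = vdet k v.
Proof. by rewrite /vdet -det_tr; congr (\det _); apply/matrixP => i j; rewrite !mxE. Qed.

Definition set_vec v n y : nat -> nat -> R := fun i => if i == n then y else v i.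

(** Cofactor expansion along the [n]-th vector; the coefficients are left
    abstract because only linearity matters later. *)
Lemma vdet_set_vec k v n : (n < k)%N ->
  exists c : nat -> R, forall y, vdet k (set_vec v n y) = \sum_(j < k) y j * c j.
Proof.
move=> nk; pose i0 := Ordinal nk.
exists (fun j => \sum_(l < k | l == j :> nat)
   cofactor (\matrix_(i < k, j < k) v i j) i0 l) => y.
rewrite /vdet (expand_det_row _ i0); apply: eq_bigr => j _.
rewrite mxE /set_vec eqxx; congr (_ * _).
rewrite (big_pred1 j) => [|l]; last by [].
rewrite /cofactor; congr (_ * \det _); apply/matrixP => p q; rewrite !mxE.
by case: eqP => // e; case/eqP: (neq_lift i0 p); apply: val_inj; exact: esym e.
Qed.

Lemma vdet_set_lin k v n a y z : (n < k)%N ->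
  vdet k (set_vec v n (fun j => y j + a * z j)) =
  vdet k (set_vec v n y) + a * vdet k (set_vec v n z).
Proof.
move=> /(vdet_set_vec v)[c e]; rewrite !e mulr_sumr -big_split /=.
by apply: eq_bigr => j _; ring.
Qed.

Lemma vdet_set_id k v n : vdet k (set_vec v n (v n)) = vdet k v.
Proof. by apply: eq_vdet => i j _ _; rewrite /set_vec; case: eqP => // ->. Qed.

Lemma vdet_alt k v i j : (i < j < k)%N ->
  (forall l, (l < k)%N -> v i l = v j l) -> vdet k v = 0.
Proof.
move=> /andP[ij jk] e; have ik := ltn_trans ij jk.
apply: (@determinant_alternate _ _ _ (Ordinal ik) (Ordinal jk)).
  by rewrite -val_eqE /= ltn_eqF.
by move=> l; rewrite !mxE e.
Qed.

(** Expanding along the [i]-th vector, or along the first one once that vector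
    has been moved to the front, produces the same cofactors up to this sign. *)
Lemma vdet_front k v i : (i < k)%N ->
  vdet k v = (-1) ^+ i * vdet k (cons_vec (v i) (v \o bump i)).
Proof.
case: k => // k ik; pose i0 : 'I_k.+1 := Ordinal ik.
rewrite /vdet (expand_det_row _ i0) (expand_det_row _ ord0) mulr_sumr.
apply: eq_bigr => j _; rewrite !mxE /= /cofactor [RHS]mulrCA; congr (_ * _).
rewrite [RHS]mulrA add0n exprD; congr (_ * \det _).
by apply/matrixP => p q; rewrite !mxE.
Qed.

(** The square matrix formed by [v] and the combination of its columns with
    coefficients [a] is singular; expand its determinant along that
    combination. *)
Lemma cramer k (v : nat -> nat -> R) (a : nat -> R) :
  \sum_(i < k.+1) (-1) ^+ i * (\sum_(j < k) a j * v i j) * vdet k (v \o bump i) = 0.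
Proof.
pose X : 'M[R]_(k.+1, k) := \matrix_(i, j) v i j.
pose y : 'cV[R]_k.+1 := X *m \col_j a j.
have : \det (row_mx y X) = 0.
  have -> : row_mx y X = X *m row_mx (\col_j a j) 1%:M by rewrite mul_mx_row mulmx1.
  (* a product through a (k+1)-column matrix that has a zero column *)
  have -> : X *m row_mx (\col_j a j) 1%:M =
      row_mx (0 : 'cV_k.+1) X *m
        col_mx (0 : 'rV_(1 + k)) (row_mx (\col_j a j) 1%:M).
    by rewrite mul_row_col mul0mx add0r.
  rewrite det_mulmx (expand_det_col _ ord0) big1 ?mul0r // => i _.
  by rewrite mxE; case: splitP => // j _; rewrite mxE mul0r.
rewrite (expand_det_col _ ord0) => e0; rewrite -[RHS]e0; apply: eq_bigr => i _.
rewrite /cofactor addn0 mulrA [X in _ = X * _]mulrC.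
congr (_ * _ * _).
  rewrite mxE; case: splitP => // j _; rewrite mxE.
  by apply: eq_bigr => l _; rewrite !mxE mulrC.
rewrite /vdet; congr (\det _); apply/matrixP => p q; rewrite !mxE.
case: splitP => [j /= |j /= ej]; first by case: j => -[].
by rewrite mxE /= -[bump 0 q]/(q.+1) in ej *; case: ej => ->.
Qed.

(** The function [y |-> om y d] vanishes on the vectors of [L], so that applying
    it to the linear dependence between [a], [b], [c] and [L] leaves three
    terms. *)
Lemma plucker_front k (L : nat -> nat -> R) (a b c d : nat -> R) : (1 < k)%N ->
  let om y z := vdet k (cons_vec y (cons_vec z L)) in
  om a c * om b d = om a b * om c d + om a d * om b c.
Proof.
case: k => [|[|k]] // _ om.
have [f fE] := vdet_set_vec (cons_vec d (cons_vec d L)) (ltn0Sn k.+1).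
have phiE y : \sum_(j < k.+2) f j * y j = om y d.
  transitivity (vdet k.+2 (set_vec (cons_vec d (cons_vec d L)) 0 y)).
    by rewrite fE; apply: eq_bigr => j _; rewrite mulrC.
  by apply: eq_vdet => -[|i] j _ _.
have := cramer k.+2 (cons_vec a (cons_vec b (cons_vec c L))) f.
under eq_bigr => i _ do rewrite phiE.
rewrite 3!big_ord_recl big1 => [|i _]; last first.
  rewrite [om _ d](@vdet_alt _ _ 0 i.+2) ?mulr0 ?mul0r //=.
  exact: (ltn_ord i).
rewrite addr0 /= -![bump 0 0]/1%N -![bump 0 1]/2%N expr0 expr1 mul1r.
have -> : vdet k.+2 (cons_vec a (cons_vec b (cons_vec c L)) \o bump 0) = om b c.
  by apply: eq_vdet => -[|[|i]].
have -> : vdet k.+2 (cons_vec a (cons_vec b (cons_vec c L)) \o bump 1) = om a c.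
  by apply: eq_vdet => -[|[|i]].
have -> : vdet k.+2 (cons_vec a (cons_vec b (cons_vec c L)) \o bump 2) = om a b.
  by apply: eq_vdet => -[|[|i]].
by move=> e; apply/eqP; rewrite -subr_eq0 -oppr_eq0 -[X in _ == X]e; apply/eqP; ring.
Qed.

Lemma vdet_front2 k v i j : (i < j < k)%N ->
  vdet k v = (-1) ^+ (i + j).+1 *
    vdet k (cons_vec (v i) (cons_vec (v j) (v \o bump j \o bump i))).
Proof.
move=> /andP[ij jk]; rewrite (vdet_front v jk).
have ik : (i.+1 < k)%N by exact: leq_ltn_trans jk.
rewrite (vdet_front _ ik) mulrA -exprD addnS addnC.
congr (_ * _); apply: eq_vdet => -[|[|p]] q _ _ //=.
  by congr v; have := bumpE j i; rewrite leqNgt ij.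
by rewrite -[bump i.+1 _]/(bump i.+1 p.+1) bumpS.
Qed.

(** The three-term Pluecker relation for [k + 2] vectors; [P i j] omits the
    vectors [i] and [j].  Moving the two remaining vectors among [a], [b], [c],
    [d] to the front reduces it to [plucker_front], with a total sign that is
    the same for the three products. *)
Lemma plucker k (x : nat -> nat -> R) (a b c d : nat) :
  (a < b)%N -> (b < c)%N -> (c < d)%N -> (d < k.+2)%N ->
  let P i j := vdet k (x \o bump j \o bump i) in
  P a c * P b d = P a b * P c d + P a d * P b c.
Proof.
move=> ab bc cd dk P; have k1 : (1 < k)%N by lia.
pose L := x \o bump d \o bump c \o bump b \o bump a.
(* when [x i] and [x j] are omitted, [x u] and [x t] have positions [p] and [q] *)
have E i j p q u t m (s : nat) : (i < j < k.+2)%N -> (p < q < k)%N ->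
    bump j (bump i p) = u -> bump j (bump i q) = t ->
    s = (p + q + m.*2)%N ->
    (forall l, bump j (bump i (bump q (bump p l))) =
               bump d (bump c (bump b (bump a l)))) ->
  P i j = (-1) ^+ s.+1 * vdet k (cons_vec (x u) (cons_vec (x t) L)).
  move=> ijk pqk <- <- -> eL; rewrite /P (vdet_front2 _ pqk) -signr_odd.
  rewrite -[in RHS]signr_odd /= [in RHS]oddD odd_double addbF.
  by congr (_ * _); apply: eq_vdet => -[|[|l]] z _ _ //=; rewrite eL.
have -> : P a c = (-1) ^+ (b + d).+2 * vdet k (cons_vec (x b) (cons_vec (x d) L)).
  by apply: (E a c b.-1 d.-2 b d 2%N) => [||||| l]; bump_lia.
have -> : P b d = (-1) ^+ (a + c).+2 * vdet k (cons_vec (x a) (cons_vec (x c) L)).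
  by apply: (E b d a c.-1 a c 1%N) => [||||| l]; bump_lia.
have -> : P a b = (-1) ^+ (c + d).+1 * vdet k (cons_vec (x c) (cons_vec (x d) L)).
  by apply: (E a b c.-2 d.-2 c d 2%N) => [||||| l]; bump_lia.
have -> : P c d = (-1) ^+ (a + b).+1 * vdet k (cons_vec (x a) (cons_vec (x b) L)).
  by apply: (E c d a b a b 0%N) => [||||| l]; bump_lia.
have -> : P a d = (-1) ^+ (b + c).+1 * vdet k (cons_vec (x b) (cons_vec (x c) L)).
  by apply: (E a d b.-1 c.-1 b c 1%N) => [||||| l]; bump_lia.
have -> : P b c = (-1) ^+ (a + d).+1 * vdet k (cons_vec (x a) (cons_vec (x d) L)).
  by apply: (E b c a d.-2 a d 1%N) => [||||| l]; bump_lia.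
have := @plucker_front k L (x a) (x b) (x c) (x d) k1; cbv zeta.
set om_ac := vdet k (cons_vec (x a) (cons_vec (x c) L)).
set om_bd := vdet k (cons_vec (x b) (cons_vec (x d) L)).
set om_ab := vdet k (cons_vec (x a) (cons_vec (x b) L)).
set om_cd := vdet k (cons_vec (x c) (cons_vec (x d) L)).
set om_ad := vdet k (cons_vec (x a) (cons_vec (x d) L)).
set om_bc := vdet k (cons_vec (x b) (cons_vec (x c) L)).
rewrite !exprS !exprD => e.
transitivity ((-1) ^+ a * (-1) ^+ b * (-1) ^+ c * (-1) ^+ d * (om_ac * om_bd)).
  by ring.
by rewrite e -/om_ab -/om_cd -/om_ad -/om_bc; ring.
Qed.

End Det.

(** * Positivity tests for maximal minors *)

Definition incr (k : nat) (f : nat -> nat) :=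
  forall i j, (i < j)%N -> (j < k)%N -> (f i < f j)%N.

Lemma incr_le k f i j : incr k f -> (i <= j)%N -> (j < k)%N ->
  (f i + (j - i) <= f j)%N.
Proof.
move=> fi ij; elim: j ij => [|j IH] ij jk; first by (have -> : i = 0%N by lia); lia.
have [->|ij'] := eqVneq i j.+1; first by lia.
have := IH ltac:(lia) ltac:(lia); have := fi j j.+1 (ltnSn j) jk; lia.
Qed.

Lemma incr_bump k f a : incr k.+1 f -> incr k (f \o bump a).
Proof. move=> fi i j ij jk; apply: fi; bump_lia. Qed.

Lemma incrW k l f : (l <= k)%N -> incr k f -> incr l f.
Proof. by move=> lk fi i j ij jl; apply: fi => //; exact: leq_trans lk. Qed.

(** Inserts the value [h i + 1] after position [i]; it is only used when this
    value is not already taken. *)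
Definition insert_gap (h : nat -> nat) i (j : nat) : nat :=
  if (j <= i)%N then h j else if j == i.+1 then (h i).+1 else h j.-1.

Lemma incr_insert_gap k h i : incr k h -> (i.+1 < k)%N ->
  ((h i).+1 < h i.+1)%N -> incr k.+1 (insert_gap h i).
Proof.
move=> hi ik gap p q pq qk; rewrite /insert_gap.
case: (leqP p i) => pi; case: (leqP q i) => qi; try lia.
- by apply: hi; lia.
- case: eqP => qi1.
    by have := @incr_le k h p i hi pi ltac:(lia); lia.
  have := @incr_le k h p i hi pi ltac:(lia).
  have := @incr_le k h i.+1 q.-1 hi ltac:(lia) ltac:(lia); lia.
- case: eqP => qi1; case: eqP => pi1; try lia.
    by have := @incr_le k h i.+1 q.-1 hi ltac:(lia) ltac:(lia); lia.
  by apply: hi; lia.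
Qed.

Lemma incr_gap k h s : incr k h -> (s < k)%N ->
  (forall j, (s <= j < k)%N -> h j = (h s + (j - s))%N) \/
  exists2 i, (s <= i)%N /\ (i.+1 < k)%N & ((h i).+1 < h i.+1)%N.
Proof.
move=> hi sk.
have [/existsP[i /andP[si gap]]|] :=
    boolP [exists i : 'I_k.-1, (s <= i)%N && ((h i).+1 != h i.+1)].
  right; exists (nat_of_ord i); first by have := ltn_ord i; lia.
  by have := hi i i.+1 (ltnSn i) ltac:(have := ltn_ord i; lia); lia.
rewrite negb_exists => /forallP ng; left => j /andP[sj jk].
elim: j sj jk => [|j IH] sj jk; first by (have -> : s = 0%N by lia); lia.
have [->|sj'] := eqVneq s j.+1; first by lia.
have jk' : (j < k.-1)%N by lia.
have := ng (Ordinal jk'); rewrite negb_and negbK /= => /orP[|/eqP <-]; first lia.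
by rewrite IH; lia.
Qed.

Ltac if_lia :=
  repeat (case: leqP => ? //=; try lia); try (case: eqP => ? //=; try lia).

Section Positivity.
Variable R : realFieldType.
Implicit Types (k : nat) (x : nat -> nat -> R) (e : nat -> R) (ep et : R).

(** The sign of one factor of a three-term Pluecker relation, when its terms
    come with two reference signs, those of [ep] and [et]. *)
Lemma exchange_pos ep et (x y p q r t : R) :
  x * y = p * q + r * t -> 0 < et * y -> 0 < ep * p -> 0 < et * q ->
  0 <= et * r -> 0 < ep * t -> 0 < ep * x.
Proof.
move=> E y0 p0 q0 r0 t0; rewrite -(pmulr_lgt0 _ y0).
have -> : ep * x * (et * y) = ep * p * (et * q) + et * r * (ep * t).
  transitivity (ep * et * (x * y)); first by ring.
  by rewrite E; ring.
by apply: ltr_pwDl; [exact: mulr_gt0 | apply: mulr_ge0 => //; exact: ltW].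
Qed.

Lemma same_sign ep (u v : R) : 0 < ep * u -> 0 < ep * v -> 0 < u * v.
Proof.
move=> u0 v0; have ep0 : ep != 0 by have := gt_eqF u0; rewrite mulf_eq0 => /norP[].
have ep2 : 0 < ep * ep by rewrite -expr2 exprn_even_gt0.
by rewrite -(pmulr_rgt0 _ ep2) mulrACA mulr_gt0.
Qed.

(** As columns of a minor: an initial run followed by a run of consecutive
    columns. *)
Definition shift_from (s t i : nat) : nat := if (s <= i)%N then (i + t)%N else i.

(** The initial run is removed step by step.  If column [s] is not chosen, it
    serves as an anchor [a]: with [b] and [d] the first and the last of the
    columns beyond the initial run, and [c] a column missing between them, the
    relation for [a < b < c < d] expresses the minor through
    minors that contain the anchor, settled at the previous step, and minors
    whose columns are less spread out. *)
Lemma vdet_gt0_of_shift_from k x ep : (0 < k)%N ->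
  (forall s t, (s < k)%N -> 0 < ep * vdet k (x \o shift_from s t)) ->
  forall h, incr k h -> 0 < ep * vdet k (x \o h).
Proof.
move=> k0 Hr.
suff main r : (r <= k)%N -> forall h, incr k h ->
    (forall i, (i < k - r)%N -> h i = i) -> 0 < ep * vdet k (x \o h).
  by move=> h hi; apply: (main k) => // i; rewrite subnn.
elim: r => [|r IHr] rk h hi hp.
  rewrite (@eq_vdet _ _ _ (x \o shift_from 0 0)); first exact: Hr.
  by move=> i j ik _; rewrite /= hp ?subn0 // /shift_from addn0.
pose s := (k - r.+1)%N; have sk : (s < k)%N by lia.
have IH h' : incr k h' -> (forall i, (i <= s)%N -> h' i = i) ->
    0 < ep * vdet k (x \o h').
  by move=> ih e; apply: IHr => // [|i ri]; [lia | apply: e; lia].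
have hs : (s <= h s)%N.
  by have := @incr_le k h 0 s hi (leq0n s) sk; lia.
have [n] := ubnP (h k.-1 - h s)%N; elim: n => // n IHn in h hi hp hs *.
rewrite ltnS => hn.
have [hss|hss] := eqVneq (h s) s.
  apply: IH => // i; rewrite leq_eqVlt => /orP[/eqP->//|]; exact: hp.
have [cons|[i [si ik] gap]] := incr_gap hi sk.
  rewrite (@eq_vdet _ _ _ (x \o shift_from s (h s - s))); first exact: Hr.
  move=> i j ik _; rewrite /shift_from /=; case: leqP => si; last by rewrite hp.
  by rewrite cons; [congr x; lia | lia].
have Fi := incr_insert_gap hi ik gap; set F := insert_gap h i in Fi.
(* the initial run, the anchor [s], the other columns of [h] and a missing one *)
pose G j := if (j <= s)%N then j else F j.-1.
have Fs : F s = h s by rewrite /F /insert_gap si.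
have Gi : incr k.+2 G.
  move=> p q pq qk; rewrite /G; case: (leqP p s) => ps; case: (leqP q s) => qs; try lia.
    by have := @incr_le _ F s q.-1 Fi ltac:(lia) ltac:(lia); lia.
  by apply: Fi; lia.
have GE j : G j = if (j <= s)%N then j else if (j <= i.+1)%N then h j.-1
    else if j == i.+2 then (h i).+1 else h j.-2.
  rewrite /G /F /insert_gap; case: leqP => // js.
  case: (leqP j.-1 i) => ji; case: (leqP j i.+1) => ji' //; try lia.
  by have -> : (j.-1 == i.+1) = (j == i.+2) by lia.
have incrG c d : incr k (G \o bump d \o bump c) by do 2 apply: incr_bump.
have anchor c d : (s < c)%N -> (s < d)%N ->
    0 < ep * vdet k (x \o G \o bump d \o bump c).
  move=> sc sd; apply: (IH _ (incrG c d)) => p ps /=.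
  have -> : bump d (bump c p) = p by bump_lia.
  by rewrite GE ps.
have narrow d : (s < d)%N ->
    (h s <= G (bump d (bump s s)))%N ->
    (G (bump d (bump s k.-1)) - G (bump d (bump s s)) < h k.-1 - h s)%N ->
    0 < ep * vdet k (x \o G \o bump d \o bump s).
  move=> sd lo sp; apply: (IHn _ (incrG s d)) => [p ps|/=|/=]; [|lia|lia].
  have -> : (G \o bump d \o bump s) p = G p by congr G; bump_lia.
  by rewrite GE; have -> : (p <= s)%N by lia.
have hsk : (h s < h k.-1)%N by apply: hi; lia.
have := @plucker R k (x \o G) s s.+1 i.+2 k.+1
  ltac:(lia) ltac:(lia) ltac:(lia) ltac:(lia).
cbv zeta; set P := fun i j => vdet k _.
have -> : P s i.+2 = vdet k (x \o h).
  apply: eq_vdet => p q pk _; rewrite /= GE; congr x.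
  have [ps|ps] := ltnP p s.
    have -> : bump i.+2 (bump s p) = p by bump_lia.
    by rewrite (ltnW ps) hp.
  have [pi|pi] := leqP p i.
    have -> : bump i.+2 (bump s p) = p.+1 by bump_lia.
    by if_lia.
  have -> : bump i.+2 (bump s p) = p.+2 by bump_lia.
  by if_lia.
move=> /exchange_pos -/(_ ep ep); apply.
- by apply: anchor; lia.
- have Gs : (h s < G s.+2)%N.
    have [si'|si'] := ltnP s i.
      have -> : G s.+2 = h s.+1 by rewrite GE; if_lia.
      by apply: hi; lia.
    have -> : G s.+2 = (h i).+1 by rewrite GE; if_lia.
    by have -> : s = i by lia.
  have Gk : G k.+1 = h k.-1.
    by rewrite GE; if_lia.
  apply: narrow; first lia.
    by have -> : bump s.+1 (bump s s) = s.+2 by [bump_lia]; lia.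
  have -> : bump s.+1 (bump s s) = s.+2 by bump_lia.
  by have -> : bump s.+1 (bump s k.-1) = k.+1 by [bump_lia]; lia.
- by apply: anchor; lia.
- apply: ltW; have Gs : G s.+1 = h s.
    by rewrite GE; if_lia.
  have Gk : (G k < h k.-1)%N.
    have [ki|ki] := eqVneq k i.+2.
      have -> : G k = (h i).+1 by rewrite GE; if_lia.
      by rewrite ki.
    have -> : G k = h k.-2 by rewrite GE; if_lia.
    by apply: hi; lia.
  have e1 : bump k.+1 (bump s s) = s.+1 by bump_lia.
  have e2 : bump k.+1 (bump s k.-1) = k by bump_lia.
  by apply: narrow; rewrite ?e1 ?e2; lia.
- by apply: anchor; lia.
Qed.

(** The vector [e] plays the role of a column at infinity.  The relation for the
    first column [b], a column [c] missing after it, the last column [d] and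
    [e] expresses the minor through less spread out ones and minors
    containing [e]; the only one of the latter that contains column [b], which
    can be [0], occurs in a product that is added to a positive term, and for
    it a weak inequality suffices. *)
Lemma vdet_gt0_of_anchor k x e ep et :
  (forall t, 0 < ep * vdet k (x \o addn t)) ->
  (forall h, incr k.-1 h -> 0 <= et * vdet k (append_vec (x \o h) k.-1 e)) ->
  (forall h, incr k.-1 h -> (0 < h 0)%N -> 0 < et * vdet k (append_vec (x \o h) k.-1 e)) ->
  forall h, incr k h -> 0 < ep * vdet k (x \o h).
Proof.
move=> Hc Hw Hs h.
have [k0|k0] := posnP k.
  move=> _; rewrite (@eq_vdet _ _ _ (x \o addn 0)) ?k0 //.
  by have := Hc 0%N; rewrite k0.
have [n] := ubnP (h k.-1 - h 0)%N; elim: n => // n IHn in h *.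
rewrite ltnS => hn hi.
have [cons|[i [_ ik] gap]] := incr_gap hi k0.
  rewrite (@eq_vdet _ _ _ (x \o addn (h 0))); first exact: Hc.
  by move=> i j ik _; rewrite /= cons ?subn0.
have Fi := incr_insert_gap hi ik gap; set F := insert_gap h i in Fi.
have FE j : F j = if (j <= i)%N then h j
    else if j == i.+1 then (h i).+1 else h j.-1 by [].
have incrF c : incr k (F \o bump c) by apply: incr_bump.
have F0 : (F 0 = h 0)%N by rewrite FE.
have Fk : F k = h k.-1 by rewrite FE; if_lia.
have F1 : (h 0 < F 1)%N by rewrite -F0; apply: Fi; lia.
have Fk1 : (F k.-1 < h k.-1)%N by rewrite -Fk; apply: Fi; lia.
have hk : (h 0 < h k.-1)%N by apply: hi; lia.
have := @plucker R k (append_vec (x \o F) k.+1 e) 0 i.+1 k k.+1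
  ltac:(lia) ltac:(lia) ltac:(lia) ltac:(lia).
cbv zeta; set P := fun i j => vdet k _.
have PE c : (c <= k)%N -> P c k.+1 = vdet k (x \o (F \o bump c)).
  move=> ck; apply: eq_vdet => p q pk _; rewrite /P /append_vec /=.
  have -> : bump k.+1 (bump c p) = bump c p by bump_lia.
  by have -> : (bump c p < k.+1)%N by bump_lia.
have QE c : (c < k)%N -> P c k = vdet k (append_vec (x \o (F \o bump c)) k.-1 e).
  move=> ck; apply: eq_vdet => p q pk _; rewrite /P /append_vec /=.
  case: (ltnP p k.-1) => pk'.
    have -> : bump k (bump c p) = bump c p by bump_lia.
    by have -> : (bump c p < k.+1)%N by bump_lia.
  by have -> : bump k (bump c p) = k.+1 by [bump_lia]; rewrite ltnn.
have Ph : P i.+1 k.+1 = vdet k (x \o h).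
  rewrite PE 1?ltnW //; apply: eq_vdet => p q pk _ /=; congr x.
  case: (leqP p i) => pi.
    by have -> : bump i.+1 p = p by [bump_lia]; rewrite FE pi.
  by have -> : bump i.+1 p = p.+1 by [bump_lia]; rewrite FE; if_lia.
have P0 : P 0 i.+1 = vdet k (append_vec (x \o (F \o bump i.+1 \o bump 0)) k.-1 e).
  apply: eq_vdet => p q pk _; rewrite /P /append_vec /=.
  case: (ltnP p k.-1) => pk'.
    by have -> : (bump i.+1 (bump 0 p) < k.+1)%N by bump_lia.
  by have -> : bump i.+1 (bump 0 p) = k.+1 by [bump_lia]; rewrite ltnn.
rewrite Ph mulrC [X in _ = X + _]mulrC [X in _ = _ + X]mulrC.
move=> /exchange_pos -/(_ ep et); apply.
- rewrite QE //; apply: Hs; first by apply: incrW (incrF 0); lia.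
  exact: leq_ltn_trans (leq0n _) F1.
- rewrite PE //; apply: IHn (incrF k).
  have e1 : bump k 0 = 0%N by bump_lia.
  have e2 : bump k k.-1 = k.-1 by bump_lia.
  by change (F (bump k k.-1) - F (bump k 0) < n)%N; rewrite e1 e2; lia.
- rewrite P0; apply: Hs.
    by apply: incr_bump; apply: incrW (incrF i.+1); lia.
  apply: (@leq_ltn_trans (F 0)) => //=; apply: Fi; bump_lia.
- by rewrite QE //; apply: Hw; apply: incrW (incrF i.+1); lia.
- rewrite PE //; apply: IHn (incrF 0).
  have e2 : bump 0 k.-1 = k by bump_lia.
  by change (F (bump 0 k.-1) - F 1%N < n)%N; rewrite e2; lia.
Qed.
End Positivity.

(** * Hankel minors and positive combinations of vectors *)

Definition hminor (R : comNzRingType) (s : nat -> R) k (f h : nat -> nat) : R :=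
  vdet k (fun j i => s (f i + h j)%N).

Lemma finite_choice (T : Type) (t0 : T) k (Q : nat -> T -> Prop) :
  (forall i, (i < k)%N -> exists t, Q i t) ->
  exists f, forall i, (i < k)%N -> Q i (f i).
Proof.
elim: k => [|k IH] H; first by exists (fun=> t0).
have [f fQ] := IH (fun i ik => H i (ltnW ik)).
have [t tQ] := H k (ltnSn k).
exists (fun i => if i == k then t else f i) => i; rewrite ltnS leq_eqVlt.
by have [->|ik] := eqVneq i k => //= ik'; exact: fQ.
Qed.

Section Ring.
Variable R : comNzRingType.

Lemma hminor_sym (s : nat -> R) k f h : hminor s k f h = hminor s k h f.
Proof. by rewrite /hminor -vdet_tr; apply: eq_vdet => i j _ _; rewrite addnC. Qed.

Lemma eq_hminor (s : nat -> R) k f h f' h' :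
  (forall i, (i < k)%N -> f i = f' i) -> (forall i, (i < k)%N -> h i = h' i) ->
  hminor s k f h = hminor s k f' h'.
Proof. by move=> ef eh; apply: eq_vdet => i j ik jk; rewrite ef ?eh. Qed.

Lemma vdet_scale k (a b : nat -> R) v :
  vdet k (fun i j => a i * b j * v i j) =
  (\prod_(i < k) a i) * (\prod_(i < k) b i) * vdet k v.
Proof.
rewrite /vdet.
have -> : \matrix_(i < k, j < k) (a i * b j * v i j) =
    diag_mx (\row_(i < k) a i) *m (\matrix_(i < k, j < k) v i j) *m
    diag_mx (\row_(i < k) b i).
  apply/matrixP => i j; rewrite mul_mx_diag mul_diag_mx !mxE; ring.
rewrite !det_mulmx !det_diag.
by under eq_bigr do rewrite mxE; under [X in _ * _ * X]eq_bigr do rewrite mxE; ring.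
Qed.

(** Subtract from each coordinate the preceding one: the constant vector becomes
    the first unit vector. *)
Lemma vdet_append_const1 k (x : nat -> nat -> R) :
  vdet k.+1 (append_vec x k (fun=> 1)) =
  (-1) ^+ k * vdet k (fun j i => x j i.+1 - x j i).
Proof.
rewrite (vdet_front _ (ltnSn k)); congr (_ * _).
pose w := cons_vec (fun=> 1) x.
rewrite (@eq_vdet _ _ _ w); last first.
  move=> [|i] j ik _; rewrite /w /cons_vec /append_vec /= ?ltnn //.
  by have -> : bump k i = i by [bump_lia]; rewrite ltnS in ik; rewrite ik.
(* right multiplication by [B] replaces each column by its difference with the
   preceding one *)
pose B : 'M[R]_k.+1 := \matrix_(i, j) ((i == j)%:R - (i.+1 == j)%:R).
have detB : \det B = 1.
  rewrite -det_tr det_trig; last first.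
    apply/is_trig_mxP => i j ij; rewrite !mxE.
    by rewrite -!val_eqE /= !(gtn_eqF, subrr) // ltnW.
  rewrite big1 // => i _; rewrite !mxE eqxx.
  by rewrite (gtn_eqF (ltnSn i)) subr0.
rewrite /vdet -[LHS]mulr1 -[X in _ * X]detB -det_mulmx (expand_det_row _ ord0).
have MB (i l : 'I_k.+1) : ((\matrix_(i < k.+1, j < k.+1) w i j) *m B) i l =
    w i l - (if l == 0%N :> nat then 0 else w i l.-1).
  rewrite mxE; under eq_bigr do rewrite !mxE mulrBr.
  rewrite big_split /= sumrN; congr (_ - _).
    rewrite (bigD1 l) //= eqxx mulr1 big1 ?addr0 // => j /negPf jl.
    by rewrite -val_eqE /= in jl *; rewrite jl mulr0.
  case: eqP => [l0|/eqP l0].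
    by rewrite big1 // => j _; rewrite l0 mulr0.
  have lk : (l.-1 < k.+1)%N by have := ltn_ord l; lia.
  rewrite (bigD1 (Ordinal lk)) //= prednK ?lt0n // eqxx mulr1 big1 ?addr0 //.
  move=> j; rewrite -val_eqE /= => jl.
  by have -> : (j.+1 == l) = false by [apply/negbTE; lia]; rewrite mulr0.
rewrite big_ord_recl big1 ?addr0 => [|i _]; last first.
  by rewrite MB /= subrr mul0r.
rewrite MB /= subr0 mul1r /cofactor expr0 mul1r; congr (\det _).
by apply/matrixP => i j; rewrite [LHS]mxE [LHS]mxE MB [RHS]mxE.
Qed.

End Ring.

(** Nonempty combinations with positive coefficients: without the zero vector,
    strict inequalities extend from generators to the cone. *)
Inductive cone (R : numDomainType) (S : (nat -> R) -> Prop) : (nat -> R) -> Prop :=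
| cone_gen a y z : 0 < a -> S y -> z =1 (fun i => a * y i) -> cone S z
| cone_add y z w : cone S y -> cone S z -> w =1 (fun i => y i + z i) -> cone S w.

Section Cone.
Variable R : realFieldType.
Implicit Types (k : nat) (x y z : nat -> R) (v : nat -> nat -> R).

Lemma vdet_set_scale k v n a y : (n < k)%N ->
  vdet k (set_vec v n (fun j => a * y j)) = a * vdet k (set_vec v n y).
Proof.
move=> /(vdet_set_vec v)[c e]; rewrite !e mulr_sumr.
by apply: eq_bigr => j _; rewrite mulrA.
Qed.

Lemma eq_vdet_set k v n y z : y =1 z -> vdet k (set_vec v n y) = vdet k (set_vec v n z).
Proof. by move=> yz; apply: eq_vdet => i j _ _; rewrite /set_vec; case: eqP. Qed.

(** By multilinearity, a property of determinants that is stable under sums and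
    positive multiples extends from generators to cones; the vectors are
    replaced one after the other. *)
Lemma cone_vdet k (P : R -> Prop) (S : nat -> (nat -> R) -> Prop) :
  (forall a r, 0 < a -> P r -> P (a * r)) ->
  (forall r t, P r -> P t -> P (r + t)) ->
  (forall v, (forall i, (i < k)%N -> S i (v i)) -> P (vdet k v)) ->
  forall v, (forall i, (i < k)%N -> cone (S i) (v i)) -> P (vdet k v).
Proof.
move=> Pscale Padd Pgen v vC.
suff main n : (n <= k)%N -> forall v, (forall i, (i < n)%N -> cone (S i) (v i)) ->
    (forall i, (n <= i < k)%N -> S i (v i)) -> P (vdet k v).
  by apply: (main k) => // i; case: leqP; rewrite ?andbF.
elim: n => [|n IH] nk {vC}v vC vS; first by apply: Pgen => i ik; apply: vS.
have IHn y : S n y -> P (vdet k (set_vec v n y)).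
  move=> Sy; apply: IH => [|i ik|i ik]; first exact: ltnW.
    by rewrite /set_vec ltn_eqF //; apply: vC; exact: ltnW.
  by rewrite /set_vec; case: eqP => [->//|/eqP ?]; apply: vS; lia.
rewrite -(vdet_set_id k v n).
elim: (vC n (ltnSn n)) => {vC}[a y z a0 Sy e|y z w _ Py _ Pz e].
  by rewrite (eq_vdet_set _ _ _ e) vdet_set_scale //; exact/Pscale/IHn.
have e1 : w =1 (fun j => y j + 1 * z j) by move=> j; rewrite mul1r e.
by rewrite (eq_vdet_set _ _ _ e1) vdet_set_lin // mul1r; exact: Padd.
Qed.

Lemma cone_vdet_gt0 k ep (S : nat -> (nat -> R) -> Prop) :
  (forall v, (forall i, (i < k)%N -> S i (v i)) -> 0 < ep * vdet k v) ->
  forall v, (forall i, (i < k)%N -> cone (S i) (v i)) -> 0 < ep * vdet k v.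
Proof.
apply: (@cone_vdet k (fun r => 0 < ep * r)) => [a r a0 r0|r t r0 t0].
  by rewrite mulrCA mulr_gt0.
by rewrite mulrDr addr_gt0.
Qed.

Lemma cone_vdet_ge0 k ep (S : nat -> (nat -> R) -> Prop) :
  (forall v, (forall i, (i < k)%N -> S i (v i)) -> 0 <= ep * vdet k v) ->
  forall v, (forall i, (i < k)%N -> cone (S i) (v i)) -> 0 <= ep * vdet k v.
Proof.
apply: (@cone_vdet k (fun r => 0 <= ep * r)) => [a r a0 r0|r t r0 t0].
  by rewrite mulrCA mulr_ge0 // ltW.
by rewrite mulrDr addr_ge0.
Qed.

Lemma eq_cone (S : (nat -> R) -> Prop) y z : cone S y -> z =1 y -> cone S z.
Proof.
case=> [a w {}y a0 Sw e|w u {}y Cw Cu e] zy.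
  by apply: (cone_gen a0 Sw) => i; rewrite zy.
by apply: (cone_add Cw Cu) => i; rewrite zy.
Qed.

Lemma cone_sum (S : (nat -> R) -> Prop) (a : nat -> R) (x : nat -> nat -> R) m n :
  (forall t, (m <= t < n)%N -> 0 <= a t) ->
  (forall t, (m <= t < n)%N -> 0 < a t -> S (x t)) ->
  (exists2 t, (m <= t < n)%N & 0 < a t) ->
  cone S (fun i => \sum_(m <= t < n) a t * x t i).
Proof.
elim: n => [|n IH] a0 aS ex; first by case: ex => t; rewrite ltn0 andbF.
have mn1 : (m <= n)%N by case: ex => t /andP[]; lia.
have an : 0 < a n -> cone S (fun i => a n * x n i).
  by move=> an0; apply: (cone_gen an0) => //; apply: aS => //; rewrite mn1 /=.
have [/hasP[t]|/hasPn no] := boolP (has (fun t => 0 < a t) (index_iota m n)).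
  rewrite mem_index_iota => tmn at0.
  have IHn : cone S (fun i => \sum_(m <= t < n) a t * x t i).
    apply: IH => [p ? |p ?|]; [apply: a0; lia | apply: aS; lia |by exists t].
  have := a0 n; rewrite mn1 ltnSn => /(_ isT); rewrite le_eqVlt.
  case/orP=> [/eqP an0|/an Cn].
    apply: (eq_cone IHn) => i.
    by rewrite big_nat_recr //= -an0 mul0r addr0.
  by apply: (cone_add IHn Cn) => i; rewrite big_nat_recr.
have an0 : 0 < a n.
  case: ex => t tmn at0; have [->//|tn] := eqVneq n t.
  by have := no t; rewrite mem_index_iota at0 => /(_ ltac:(lia)).
apply: (cone_gen an0 (y := x n)) => [|i].
  by apply: aS => //; rewrite mn1 /=.
rewrite big_nat_recr //= big_nat big1 ?add0r // => p pn.
have := no p; rewrite mem_index_iota pn => /(_ isT).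
by rewrite lt_def a0 ?andbT ?negbK; [move=> /eqP ->; rewrite mul0r | lia].
Qed.

(** Starting from the positive [vdet k z], replace the vectors [z i] by
    [y i + de * z i] one after the other: each step adds a nonnegative
    determinant to a positive multiple of the previous one. *)
Lemma vdet_smooth k (y z : nat -> nat -> R) ep de : 0 < de ->
  (forall b : nat -> bool, 0 <= ep * vdet k (fun i => if b i then z i else y i)) ->
  0 < ep * vdet k z -> 0 < ep * vdet k (fun i j => y i j + de * z i j).
Proof.
move=> de0 Hw Hs.
suff main n : (n <= k)%N ->
    0 < ep * vdet k (fun i j => if (i < n)%N then y i j + de * z i j else z i j).
  rewrite (@eq_vdet _ _ _ (fun i j => if (i < k)%N then y i j + de * z i j else z i j)).
    exact: main.
  by move=> i j ->.
elim: n => [|n IH] nk; first by [].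
set v := fun i j => _; pose u i j := if (i < n)%N then y i j + de * z i j else z i j.
have -> : vdet k v = vdet k (set_vec u n (y n)) + de * vdet k (set_vec u n (z n)).
  rewrite -vdet_set_lin //; apply: eq_vdet => i j _ _; rewrite /v /u /set_vec ltnS.
  by case: ltngtP => // ->.
have -> : vdet k (set_vec u n (z n)) = vdet k u.
  rewrite -[RHS](vdet_set_id k _ n); apply: eq_vdet => i j _ _.
  by rewrite /u /set_vec ltnn.
rewrite mulrDr mulrCA; apply: ltr_wpDl; last by rewrite mulr_gt0 // IH // ltnW.
apply: (@cone_vdet_ge0 k ep (fun i x => x =1 y i \/ x =1 z i)).
  move=> w wS; have [b bP] : exists b : nat -> bool, forall i, (i < k)%N ->
      w i =1 if b i then z i else y i.
    apply: (@finite_choice bool true k (fun i b => w i =1 if b then z i else y i)).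
    by move=> i ik; case: (wS i ik); [exists false | exists true].
  rewrite (@eq_vdet _ _ _ (fun i => if b i then z i else y i)) // => i j ik _.
  exact: bP.
move=> i ik; rewrite /set_vec; case: eqP => [->|_].
  by apply: (@cone_gen _ _ 1 (y n)) => [|//|j]; rewrite ?mul1r //; left.
have Cz : cone (fun x => x =1 y i \/ x =1 z i) (z i).
  by apply: (@cone_gen _ _ 1 (z i)) => [||j]; rewrite ?mul1r //; right.
rewrite /u; case: ltnP => // _.
apply: (@cone_add _ _ (y i) (fun j => de * z i j)) => //.
  by apply: (@cone_gen _ _ 1 (y i)) => [||j]; rewrite ?mul1r //; left.
by apply: (@cone_gen _ _ de (z i)) => //; right.
Qed.

(** Perturbing [s] by a small multiple of its shift mixes each column with the
    next one.  The columns of the resulting determinants are either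
    increasing, or two of them coincide; and moving all of them one step
    away from column [0] gives a strictly positive contribution. *)
Lemma hminor_smooth k (s : nat -> R) ep de : 0 < de ->
  (forall h, incr k h -> 0 <= ep * hminor s k id h) ->
  (forall h, incr k h -> (0 < h 0)%N -> 0 < ep * hminor s k id h) ->
  forall h, incr k h -> 0 < ep * hminor (fun t => s t + de * s t.+1) k id h.
Proof.
move=> de0 Hw Hs h hi.
rewrite /hminor; apply: (@vdet_smooth k (fun j i => s (i + h j)%N)
  (fun j i => s (i + h j).+1)) => // [b|].
  pose K i := (h i + b i)%N.
  have -> : vdet k (fun i => if b i then fun l => s (l + h i).+1
      else fun l => s (l + h i)%N) = hminor s k id K.
    by apply: eq_vdet => i j _ _; rewrite /K; case: (b i); rewrite ?addn1 ?addnS ?addn0.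
  have [/existsP[i /eqP e]|] := boolP [exists i : 'I_k.-1, K i == K i.+1].
    have ik : (i.+1 < k)%N by have := ltn_ord i; lia.
    rewrite /hminor (@vdet_alt _ _ _ i i.+1) ?mulr0 ?ltnSn // => l _.
    by rewrite e.
  rewrite negb_exists => /forallP ne; apply: Hw => i j ij jk.
  have step l : (l.+1 < k)%N -> (K l < K l.+1)%N.
    move=> lk; have lk' : (l < k.-1)%N by lia.
    have /= := ne (Ordinal lk'); have := hi l l.+1 (ltnSn l) lk.
    by rewrite /K; case: (b l); case: (b l.+1) => /=; lia.
  elim: j => // j IH in ij jk *; rewrite ltnS leq_eqVlt in ij.
  case/orP: ij => [/eqP ->|ij]; first exact: step.
  by apply: ltn_trans (step j jk); apply: IH; lia.
have -> : vdet k (fun j i => s (i + h j).+1) = hminor s k id (fun i => (h i).+1).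
  by apply: eq_vdet => i j _ _; rewrite addnS.
by apply: Hs => // i j ij jk; rewrite ltnS hi.
Qed.

End Cone.

(** * A column at infinity *)

Section Anchor.
Variable R : realFieldType.
Implicit Types (k : nat) (s : nat -> R) (x : nat -> nat -> R) (e : nat -> R).

(** If the determinant of [x (h 0)], ..., [e] vanished, the relations between
    [x 0], these vectors, one further [x c] and [e] would be sums of
    nonnegative terms equal to zero.  Hence all determinants
    that replace one of the vectors of [h] by [x 0] would vanish too, and so
    would [e], expanded in the basis formed by [x 0] and the vectors of
    [h]. *)
Lemma vdet_append_weak_strict k x e ep et : (0 < k)%N ->
  e 0%N != 0 -> et != 0 ->
  (forall h, incr k.+1 h -> 0 < ep * vdet k.+1 (x \o h)) ->
  (forall h, incr k h -> 0 <= et * vdet k.+1 (append_vec (x \o h) k e)) ->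
  forall h, incr k h -> (0 < h 0)%N -> 0 < et * vdet k.+1 (append_vec (x \o h) k e).
Proof.
move=> k0 e0 et0 Hs Hw h hi h0; rewrite lt_def Hw // andbT.
rewrite mulf_eq0 (negPf et0) /=; apply/eqP => Z.
(* the indices [0], [h 0], ..., [h (k-1)], followed by larger ones *)
pose F i := if i is i'.+1 then if (i' < k)%N then h i' else (h k.-1 + i' - k).+1 else 0%N.
have Fi : incr k.+2 F.
  move=> [|i] [|j] // ij jk.
    rewrite /F /=; case: (ltnP j k) => // jk'; apply: leq_trans h0 _.
    by have [->//|j0] := posnP j; apply: ltnW; apply: hi; lia.
  rewrite /F /=; case: (ltnP i k) => ik; case: (ltnP j k) => jk'; try lia.
    by apply: hi; lia.
  by have := @incr_le k h i k.-1 hi ltac:(lia) ltac:(lia); lia.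
have incrF c : incr k.+1 (F \o bump c) by apply: incr_bump.
have incrF2 c c' : incr k (F \o bump c \o bump c').
  by apply: incr_bump.
pose y := append_vec (x \o F) k.+2 e.
pose P c c' := vdet k.+1 (y \o bump c' \o bump c).
have PE c : (c <= k.+1)%N -> P c k.+2 = vdet k.+1 (x \o (F \o bump c)).
  move=> ck; apply: eq_vdet => p q pk _; rewrite /P /y /append_vec /=.
  have -> : bump k.+2 (bump c p) = bump c p by bump_lia.
  by have -> : (bump c p < k.+2)%N by bump_lia.
have QE c c' : (c < c' < k.+2)%N ->
    P c c' = vdet k.+1 (append_vec (x \o (F \o bump c' \o bump c)) k e).
  move=> ck; apply: eq_vdet => p q pk _; rewrite /P /y /append_vec /=.
  case: (ltnP p k) => pk'.
    by have -> : (bump c' (bump c p) < k.+2)%N by bump_lia.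
  by have -> : bump c' (bump c p) = k.+2 by [bump_lia]; rewrite ltnn.
have Z0 : P 0%N k.+1 = 0.
  rewrite QE ?ltnSn //; apply: etrans Z.
  apply: eq_vdet => p q pk _; rewrite /append_vec; case: ltnP => //= pk'.
  have -> : bump k.+1 (bump 0 p) = p.+1 by bump_lia.
  by rewrite /F /= pk'.
have Pz c : (c < k.+1)%N -> P c k.+1 = 0.
  have [->//|c0 ck] := posnP c.
  have : P 0%N k.+1 * P c k.+2 = P 0%N c * P k.+1 k.+2 + P 0%N k.+2 * P c k.+1.
    exact: (@plucker R k.+1 y 0 c k.+1 k.+2 c0 ck (ltnSn _) (ltnSn _)).
  rewrite Z0 mul0r => /esym E.
  have A : 0 <= et * P 0%N c * (ep * P k.+1 k.+2).
    apply: mulr_ge0; last by rewrite PE //; apply/ltW/Hs.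
    rewrite QE; first exact: (Hw _ (incrF2 c 0%N)).
    by rewrite c0 ltnW.
  have B : 0 <= et * P c k.+1.
    rewrite QE; first exact: (Hw _ (incrF2 k.+1 c)).
    by rewrite ck ltnSn.
  have C : 0 < ep * P 0%N k.+2 by rewrite PE //; apply/Hs.
  have : et * P 0%N c * (ep * P k.+1 k.+2) + (et * P c k.+1) * (ep * P 0%N k.+2) = 0.
    transitivity (et * ep * (P 0%N c * P k.+1 k.+2 + P 0%N k.+2 * P c k.+1)).
      by ring.
    by rewrite E mulr0.
  move/eqP; rewrite paddr_eq0 //; last exact: mulr_ge0 (ltW C).
  case/andP=> _; rewrite !mulf_eq0 (negPf et0) /=.
  by have := gt_eqF C; rewrite mulf_eq0 => -> /orP[/eqP|].
have := cramer k.+1 (y \o bump k.+1) (fun i => (i == 0%N)%:R).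
rewrite big_ord_recr /= big1 => [|i _]; last first.
  by rewrite [X in _ * X](Pz i (ltn_ord i)) mulr0.
rewrite add0r big_ord_recl big1 => [|i _]; last by rewrite mul0r.
rewrite addr0 mul1r /=.
have -> : vdet k.+1 ((y \o bump k.+1) \o bump k.+1) = P k.+1 k.+2.
  by apply: eq_vdet => p q pk _ /=; congr y; bump_lia.
have -> : y (bump k.+1 k.+1) 0%N = e 0%N.
  by rewrite /y /append_vec; have -> : bump k.+1 k.+1 = k.+2 by [bump_lia]; rewrite ltnn.
move/eqP; rewrite !mulf_eq0 signr_eq0 (negPf e0) /= PE //.
by have := gt_eqF (Hs _ (incrF k.+1)); rewrite mulf_eq0 => /norP[_ /negPf ->].
Qed.

(** A minor with rows [f] and the all-one column is, up to sign, the determinant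
    of the differences of consecutive rows.  Each of these rows is a
    telescoping sum of rows of the difference sequence [d], so multilinearity
    writes the determinant as a sum of minors of [d] whose rows interlace
    [f].  This gives the hypotheses of [vdet_gt0_of_anchor] about the column
    at infinity. *)
Lemma hminor_gt0_of_anchor k (G : nat -> R) (ep et : R) :
  (forall h, incr k.+1 h -> 0 < ep * hminor G k.+1 id h) ->
  let d t := G t.+1 - G t in let et' := et * (-1) ^+ k in
  (forall f h, incr k f -> incr k h -> 0 <= et' * hminor d k f h) ->
  (forall f h, incr k f -> incr k h -> (0 < h 0)%N -> 0 < et' * hminor d k f h) ->
  forall f h, incr k.+1 f -> incr k.+1 h -> 0 < ep * hminor G k.+1 f h.
Proof.
move=> Hc d et' Hw Hs f h fi hi.
have E h' : et * vdet k.+1 (append_vec (fun j i => G (f i + h' j)%N) k (fun=> 1)) =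
    et' * vdet k (fun i j => \sum_(f i <= t < f i.+1) 1 * d (t + h' j)%N).
  rewrite vdet_append_const1 mulrA; congr (_ * _); rewrite -vdet_tr.
  apply: eq_vdet => i j ik jk.
  rewrite (eq_bigr (fun t => G (t.+1 + h' j)%N - G (t + h' j)%N)) => [|t _]; last first.
    by rewrite mul1r.
  rewrite (@telescope_sumr _ _ _ (fun t => G (t + h' j)%N)) //.
  by apply: ltnW; apply: fi; lia.
have gen (v : nat -> nat -> R) h' :
    (forall i, (i < k)%N -> exists2 t, (f i <= t < f i.+1)%N &
       v i =1 (fun j => d (t + h' j)%N)) ->
    exists2 f', incr k f' & vdet k v = hminor d k f' h'.
  move=> vt; have [f' f'P] := @finite_choice nat 0%N k
    (fun i t => (f i <= t < f i.+1)%N /\ v i =1 (fun j => d (t + h' j)%N))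
    (fun i ik => let: ex_intro2 t a b := vt i ik in ex_intro _ t (conj a b)).
  exists f'; last first.
    by rewrite hminor_sym; apply: eq_vdet => i j ik jk; rewrite (f'P i ik).2 addnC.
  move=> i j ij jk; have [/andP[_ a] _] := f'P i ltac:(lia).
  have [/andP[b _] _] := f'P j jk.
  apply: leq_trans a _; apply: leq_trans b.
  have := @incr_le k.+1 f i.+1 j fi ij ltac:(lia); lia.
pose S (h' : nat -> nat) i (y : nat -> R) :=
  exists2 t, (f i <= t < f i.+1)%N & y = (fun j => d (t + h' j)%N).
have Cone h' i : (i < k)%N ->
    cone (S h' i) (fun j => \sum_(f i <= t < f i.+1) 1 * d (t + h' j)%N).
  move=> ik; apply: (@cone_sum _ _ (fun=> 1) (fun t j => d (t + h' j)%N)) => // [t tf _|].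
    by exists t.
  by exists (f i); rewrite // leqnn fi //; lia.
change (0 < ep * vdet k.+1 ((fun j i => G (f i + j)%N) \o h)).
apply: (@vdet_gt0_of_anchor _ k.+1 (fun j i => G (f i + j)%N) (fun=> 1) ep et) => //=.
- move=> t.
  (* consecutive columns: the Hankel matrix is symmetric *)
  have -> : vdet k.+1 ((fun j i => G (f i + j)%N) \o addn t) =
      hminor G k.+1 id (fun j => f j + t)%N.
    by rewrite hminor_sym; apply: eq_vdet => i j _ _ /=; congr G; lia.
  by apply: Hc => i j ij jk; rewrite ltn_add2r fi.
- move=> h' hi'.
  rewrite [X in _ <= _ * X](_ : _ =
    vdet k.+1 (append_vec (fun j i => G (f i + h' j)%N) k (fun=> 1))) //.
  rewrite E; apply: (@cone_vdet_ge0 _ k et' (S h')) => [v vS|i ik]; last exact: Cone.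
  have [i ik|f' fi' ->] := gen v h'; last exact: Hw.
  by have [t tf ->] := vS i ik; exists t.
- move=> h' hi' h0.
  rewrite [X in _ < _ * X](_ : _ =
    vdet k.+1 (append_vec (fun j i => G (f i + h' j)%N) k (fun=> 1))) //.
  rewrite E; apply: (@cone_vdet_gt0 _ k et' (S h')) => [v vS|i ik]; last exact: Cone.
  have [i ik|f' fi' ->] := gen v h'; last exact: Hs.
  by have [t tf ->] := vS i ik; exists t.
Qed.

End Anchor.

(** * Limits and linear recurrences *)

Section Limits.
Local Open Scope classical_set_scope.
Variable R : realType.
Implicit Types (k : nat) (s : nat -> R) (f h : nat -> nat).

Lemma cvg_near_eq (u v : nat -> R) (l : R) :
  (\forall n \near \oo, u n = v n) -> u n @[n --> \oo] --> l -> v n @[n --> \oo] --> l.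
Proof. by move=> uv; apply: cvg_trans; apply: near_eq_cvg; apply: filterS uv. Qed.

Lemma cvg_mulr (u v : nat -> R) (a b : R) :
  u n @[n --> \oo] --> a -> v n @[n --> \oo] --> b ->
  u n * v n @[n --> \oo] --> a * b.
Proof. by move=> ua vb; apply: cvgM. Qed.

Lemma cvg_divr (u v : nat -> R) (a b : R) : b != 0 ->
  u n @[n --> \oo] --> a -> v n @[n --> \oo] --> b ->
  u n / v n @[n --> \oo] --> a / b.
Proof. by move=> b0 ua vb; apply: cvgM => //; apply: cvgV. Qed.

Lemma cvg_neq0 (u : nat -> R) (a : R) : a != 0 -> u n @[n --> \oo] --> a ->
  \forall n \near \oo, u n != 0.
Proof. by move=> a0 ua; exact: (cvgr_neq0 a ua a0). Qed.

Lemma cvg_sumr (I : Type) (r : seq I) (u : I -> nat -> R) (l : I -> R) :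
  (forall i, u i n @[n --> \oo] --> l i) ->
  (\sum_(i <- r) u i n) @[n --> \oo] --> \sum_(i <- r) l i.
Proof. by move=> ul; apply: cvg_big => // x; exact: add_continuous. Qed.

Lemma cvg_prodr (I : Type) (r : seq I) (u : I -> nat -> R) (l : I -> R) :
  (forall i, u i n @[n --> \oo] --> l i) ->
  (\prod_(i <- r) u i n) @[n --> \oo] --> \prod_(i <- r) l i.
Proof. by move=> ul; apply: cvg_big => // x; exact: mul_continuous. Qed.

Lemma cvg_vdet k (v : nat -> nat -> nat -> R) (w : nat -> nat -> R) :
  (forall i j, (i < k)%N -> (j < k)%N -> v n i j @[n --> \oo] --> w i j) ->
  vdet k (v n) @[n --> \oo] --> vdet k w.
Proof.
move=> vw; apply: cvg_sumr => sg; apply: cvgM; first exact: cvg_cst.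
apply: cvg_prodr => i; rewrite mxE; under eq_cvg do rewrite mxE.
by apply: vw.
Qed.

(** Let [de] tend to [0]. *)
Lemma hminor_weak_limit k s (ep : R) f h :
  (forall de : R, 0 < de -> 0 < ep * hminor (fun t => s t + de * s t.+1) k f h) ->
  0 <= ep * hminor s k f h.
Proof.
move=> H; pose u n := ep * hminor (fun t => s t + harmonic n * s t.+1) k f h.
have ul : u n @[n --> \oo] --> ep * hminor s k f h.
  rewrite /u.
  apply: cvgMl_tmp; apply: (@cvg_vdet k (fun n j i =>
    s (f i + h j)%N + harmonic n * s (f i + h j).+1)) => i j _ _.
  rewrite -[X in _ --> X]addr0; apply: cvgD; first exact: cvg_cst.
  rewrite -(mul0r (s (f j + h i).+1)%N); apply: cvgMr_tmp.
  exact: cvg_harmonic.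
rewrite -(cvg_lim _ ul) //; apply: limr_ge; first by apply/cvg_ex; eexists; exact: ul.
by near=> n; apply/ltW/H; rewrite /harmonic invr_gt0.
Unshelve. all: by end_near. Qed.

(** The two extreme coefficients are nonzero: this prevents both superexponential
    growth and superexponential decay. *)
Definition eventually_recurrent s := exists (q : nat -> R) (d N : nat),
  [/\ q 0%N != 0, q d != 0 &
      forall t, (N <= t)%N -> \sum_(i < d.+1) q i * s (t + i)%N = 0].

Lemma recurrent_shift s a b : eventually_recurrent s ->
  eventually_recurrent (fun t => a * s t + b * s t.+1).
Proof.
move=> [q [d [N [q0 qd H]]]]; exists q, d, N; split=> // t Nt.
under eq_bigr do rewrite mulrDr mulrCA (mulrCA _ b) -addSn.
by rewrite big_split /= -!mulr_sumr !H ?mulr0 ?addr0 // ltnW // ltnS.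
Qed.

Lemma recurrent_scale s (l : R) : l != 0 -> eventually_recurrent s ->
  eventually_recurrent (fun t => l ^+ t * s t).
Proof.
move=> l0 [q [d [N [q0 qd H]]]]; exists (fun i => q i * (l ^+ i)^-1), d, N.
split; rewrite ?mulf_neq0 ?invr_eq0 ?expf_neq0 // => t Nt.
transitivity (l ^+ t * \sum_(i < d.+1) q i * s (t + i)%N); last by rewrite H ?mulr0.
rewrite mulr_sumr; apply: eq_bigr => i _.
by rewrite exprD; field; rewrite expf_neq0.
Qed.

(** A ratio at distance [i] is a product of [i] consecutive ratios. *)
Lemma ratio_cvg0 (p : nat -> R) : (forall j, p j != 0) ->
  p j.+1 / p j @[j --> \oo] --> 0 ->
  forall i, (0 < i)%N -> p (j + i)%N / p j @[j --> \oo] --> 0.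
Proof.
move=> p0 r0; elim=> // -[|i] IH _; first by under eq_cvg do rewrite addn1.
rewrite -(mul0r (0 : R)).
have -> : (fun j => p (j + i.+2)%N / p j) =
   (fun j => (p (j + i.+1).+1 / p (j + i.+1)%N) * (p (j + i.+1)%N / p j)).
  by apply/funext => j; rewrite addnS; field; rewrite !p0.
apply: cvgM; last exact: IH.
by move: r0; rewrite -(cvg_shiftn i.+1).
Qed.

(** Divided by [p j], the recurrence would tend to its coefficient of lowest
    index. *)
Lemma recurrent_ratio_not0 (p : nat -> R) : (forall j, p j != 0) -> eventually_recurrent p ->
  ~ (p j.+1 / p j @[j --> \oo] --> 0).
Proof.
move=> p0 [q [d [N [q0 qd H]]]] r0.
have : \sum_(i < d.+1) q i * (p (j + i)%N / p j) @[j --> \oo] -->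
       \sum_(i < d.+1) (if i == 0%N :> nat then q 0%N else 0).
  apply: cvg_sumr => i; case: eqP => [->|/eqP i0].
    apply: cvg_near_cst; apply: nearW => j.
    by rewrite addn0 divff // mulr1.
  by rewrite -(mulr0 (q i)); apply: cvgMl_tmp; apply: ratio_cvg0 => //; rewrite lt0n.
rewrite big_ord_recl big1 //= addr0.
have : \sum_(i < d.+1) q i * (p (j + i)%N / p j) @[j --> \oo] --> 0.
  apply: cvg_near_cst; near=> j.
  under eq_bigr do rewrite mulrA.
  rewrite -mulr_suml H ?mul0r //; near: j; exact: nbhs_infty_ge.
move=> c0 c1; have e : q 0%N = 0 := cvg_unique (@Rhausdorff R) c1 c0.
by rewrite e eqxx in q0.
Unshelve. all: by end_near. Qed.

(** Divided by its last term, the recurrence would tend to its coefficient of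
    highest index. *)
Lemma recurrent_ratio_not_infty (p : nat -> R) : (forall j, p j != 0) -> eventually_recurrent p ->
  ~ (p j / p j.+1 @[j --> \oo] --> 0).
Proof.
move=> p0 [q [d [N [q0 qd H]]]] r0.
have pV i : (0 < i)%N -> p j / p (j + i)%N @[j --> \oo] --> 0.
  have V : (fun j => (p j.+1)^-1 / (p j)^-1) = (fun j => p j / p j.+1).
    by apply/funext => j; rewrite invrK mulrC.
  move=> i0; have := @ratio_cvg0 (fun j => (p j)^-1) (fun j => invr_neq0 (p0 j)).
  rewrite V => /(_ r0 i i0).
  by under eq_cvg do rewrite invrK mulrC.
have : \sum_(i < d.+1) q i * (p (j + i)%N / p (j + d)%N) @[j --> \oo] -->
       \sum_(i < d.+1) (if i == d :> nat then q d else 0).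
  apply: cvg_sumr => i; case: eqP => [->|/eqP id].
    by apply: cvg_near_cst; apply: nearW => j; rewrite divff // mulr1.
  rewrite -(mulr0 (q i)); apply: cvgMl_tmp.
  have di : (0 < d - i)%N by have := ltn_ord i; lia.
  have := pV _ di; rewrite -(cvg_shiftn i).
  rewrite (_ : (fun n => _) = (fun j => p (j + i)%N / p (j + d)%N)) //.
  by apply/funext => j /=; rewrite -addnA subnKC // -ltnS.
rewrite big_ord_recr big1 /= ?eqxx ?add0r => [|i _]; last by rewrite ltn_eqF.
have : \sum_(i < d.+1) q i * (p (j + i)%N / p (j + d)%N) @[j --> \oo] --> 0.
  apply: cvg_near_cst; near=> j.
  under eq_bigr do rewrite mulrA.
  rewrite -mulr_suml H ?mul0r //; near: j; exact: nbhs_infty_ge.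
move=> c0 c1; have e : q d = 0 := cvg_unique (@Rhausdorff R) c1 c0.
by rewrite e eqxx in qd.
Unshelve. all: by end_near. Qed.

End Limits.

(** * Convergence of the normalized windows *)

Section AnchorExists.
Local Open Scope classical_set_scope.
Variable R : realType.
Implicit Types (k : nat) (s : nat -> R) (f h : nat -> nat).

Lemma vdet_append_lin k (v : nat -> nat -> R) :
  exists c : nat -> R, forall y, vdet k.+1 (append_vec v k y) = \sum_(j < k.+1) y j * c j.
Proof.
have [c cE] := vdet_set_vec v (ltnSn k); exists c => y; rewrite -cE.
by apply: eq_vdet => i j; rewrite ltnS /append_vec /set_vec; case: (ltngtP i k).
Qed.

Lemma recurrent_comb s m (c : nat -> R) N : eventually_recurrent s ->
  eventually_recurrent (fun t => \sum_(i < m) s (i + (t + N))%N * c i).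
Proof.
move=> [q [d [M [q0 qd H]]]]; exists q, d, M; split=> // t Mt.
under eq_bigr do rewrite mulr_sumr.
rewrite exchange_big big1 //= => i _.
transitivity ((\sum_(j < d.+1) q j * s (t + (N + i) + j)%N) * c i).
  rewrite mulr_suml; apply: eq_bigr => j _; rewrite mulrA; congr (_ * s _ * _); lia.
by rewrite H ?mul0r //; lia.
Qed.

Variables (m : nat) (s : nat -> R) (ep : R).
Hypothesis Hs : forall h, incr m.+2 h -> 0 < ep * hminor s m.+2 id h.

Let x j i := s (i + j)%N.
(** The determinants [psi a j] are, up to sign and to the common factor [D0],
    the coordinates of [x j] in the basis [x 0], ..., [x (m+1)]. *)
Let psi a j := vdet m.+2 (append_vec (x \o bump a) m.+1 (x j)).

Let psi_gt0 a j : (a < m.+2)%N -> (m.+2 <= j)%N -> 0 < ep * psi a j.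
Proof.
move=> am mj; have -> : psi a j = hminor s m.+2 id (append_vec (bump a) m.+1 j).
  by apply: eq_vdet => p q _ _; rewrite /append_vec /=; case: ifP.
apply: Hs => p q pq qm; rewrite /append_vec; case: (ltnP p m.+1) => pm; last by lia.
case: (ltnP q m.+1) => qm'; bump_lia.
Qed.

Let psi_neq0 a j : (a < m.+2)%N -> (m.+2 <= j)%N -> psi a j != 0.
Proof.
by move=> am mj; have := gt_eqF (psi_gt0 am mj); rewrite mulf_eq0 => /norP[].
Qed.

Let D0 := hminor s m.+2 id id.

Let D0_neq0 : D0 != 0.
Proof. by have := gt_eqF (@Hs id (fun _ _ ij _ => ij)); rewrite mulf_eq0 => /norP[]. Qed.

(** This is the Pluecker relation for [x 0], [x a], [x j] and [x j']. *)
Let psi_mono a j j' : (0 < a < m.+2)%N -> (m.+2 <= j < j')%N ->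
  psi a j' / psi 0%N j' <= psi a j / psi 0%N j.
Proof.
move=> am jj'.
pose F i := if (i < m.+2)%N then i else if i == m.+2 then j else j'.
have Fi : incr m.+4 F.
  move=> p q pq qm; rewrite /F; case: (ltnP p m.+2) => ?; case: (ltnP q m.+2) => ?;
  do ?case: eqP => ?; lia.
pose P c c' := vdet m.+2 ((x \o F) \o bump c' \o bump c).
have PE c c' : 0 < ep * P c c'.
  by apply: (@Hs (F \o bump c' \o bump c)); do 2 apply: incr_bump.
have Pj c : (c < m.+2)%N -> P c m.+2 = psi c j'.
  move=> cm; apply: eq_vdet => p q pm _; rewrite /P /append_vec /=.
  case: (ltnP p m.+1) => pm'.
    have -> : bump m.+2 (bump c p) = bump c p by bump_lia.
    by have bm : (bump c p < m.+2)%N by [bump_lia]; rewrite /F bm.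
  have -> : bump m.+2 (bump c p) = m.+3 by bump_lia.
  by rewrite /F; if_lia.
have Pj' c : (c < m.+2)%N -> P c m.+3 = psi c j.
  move=> cm; apply: eq_vdet => p q pm _; rewrite /P /append_vec /=.
  case: (ltnP p m.+1) => pm'.
    have -> : bump m.+3 (bump c p) = bump c p by bump_lia.
    by have bm : (bump c p < m.+2)%N by [bump_lia]; rewrite /F bm.
  have -> : bump m.+3 (bump c p) = m.+2 by bump_lia.
  by rewrite /F; if_lia.
have [a0 am'] := andP am.
have E : P 0%N m.+2 * P a m.+3 = P 0%N a * P m.+2 m.+3 + P 0%N m.+3 * P a m.+2.
  exact: (@plucker R m.+2 (x \o F) 0 a m.+2 m.+3 a0 am' (ltnSn _) (ltnSn _)).
rewrite (Pj 0%N) // (Pj a) // (Pj' 0%N) // (Pj' a) // in E.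
have p1 : 0 < ep * psi 0%N j by apply: psi_gt0; lia.
have p2 : 0 < ep * psi 0%N j' by apply: psi_gt0; lia.
have n1 : psi 0%N j != 0 by apply: psi_neq0; lia.
have n2 : psi 0%N j' != 0 by apply: psi_neq0; lia.
have pp : 0 < psi 0%N j * psi 0%N j' by apply: same_sign p1 p2.
have PP : 0 < P 0%N a * P m.+2 m.+3 by apply: same_sign (PE _ _) (PE _ _).
rewrite -subr_ge0.
have -> : psi a j / psi 0%N j - psi a j' / psi 0%N j' =
   P 0%N a * P m.+2 m.+3 / (psi 0%N j * psi 0%N j').
  have -> : P 0%N a * P m.+2 m.+3 = psi 0%N j' * psi a j - psi 0%N j * psi a j'.
    by rewrite E addrK.
  by field; rewrite n1 n2.
by rewrite divr_ge0 // ltW.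
Qed.

Let cvg_psi a : (a < m.+2)%N ->
  exists l : R, psi a (j + m.+2)%N / psi 0%N (j + m.+2)%N @[j --> \oo] --> l.
Proof.
move=> am; have [->|a0] := posnP a.
  exists 1; apply: cvg_near_cst; apply: nearW => j.
  by rewrite divff // psi_neq0 // leq_addl.
set u := fun j : nat => psi a (j + m.+2)%N / psi 0%N (j + m.+2)%N.
suff : cvgn u by move=> /cvg_ex.
apply: nonincreasing_is_cvgn.
  move=> i j; rewrite leq_eqVlt => /orP[/eqP->//|ij]; apply: psi_mono; lia.
exists 0 => _ [j _ <-]; rewrite /u.
have jm : (m.+2 <= j + m.+2)%N by exact: leq_addl.
have -> : psi a (j + m.+2)%N / psi 0%N (j + m.+2)%N =
    psi a (j + m.+2)%N * psi 0%N (j + m.+2)%N / psi 0%N (j + m.+2)%N ^+ 2.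
  by field; rewrite psi_neq0.
rewrite divr_ge0 // ?sqr_ge0 // ltW //.
exact: same_sign (psi_gt0 am jm) (psi_gt0 (ltn0Sn _) jm).
Qed.

(** The coordinates of [x j] in the basis, divided by the one with index [0], are
    monotone and bounded. *)
Let window_lim : exists e : nat -> R, (exists2 i, (i < m.+2)%N & e i != 0) /\
  forall i, (i < m.+2)%N ->
    s (i + (j + m.+2))%N / psi 0%N (j + m.+2) @[j --> \oo] --> e i.
Proof.
have [l lP] : exists l : nat -> R, forall a, (a < m.+2)%N ->
    psi a (j + m.+2)%N / psi 0%N (j + m.+2)%N @[j --> \oo] --> l a.
  by apply: (@finite_choice R 0 m.+2 (fun a l =>
    psi a (j + m.+2)%N / psi 0%N (j + m.+2)%N @[j --> \oo] --> l) cvg_psi).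
pose e i := - ((-1) ^+ m.+2 * D0)^-1 * \sum_(a < m.+2) (-1) ^+ a * s (i + a)%N * l a.
have eP i : (i < m.+2)%N ->
    s (i + (j + m.+2))%N / psi 0%N (j + m.+2) @[j --> \oo] --> e i.
  move=> im.
  have -> : (fun j => s (i + (j + m.+2))%N / psi 0%N (j + m.+2)) = (fun j => 
    - ((-1) ^+ m.+2 * D0)^-1 * \sum_(a < m.+2) (-1) ^+ a * s (i + a)%N *
        (psi a (j + m.+2) / psi 0%N (j + m.+2))).
    apply/funext => j; pose y := append_vec x m.+2 (x (j + m.+2)%N).
    have yi p : \sum_(q < m.+2) (q == i :> nat)%:R * y p q = y p i.
      rewrite (bigD1 (Ordinal im)) //= eqxx mul1r big1 ?addr0 // => q.
      by rewrite -val_eqE /= => /negPf ->; rewrite mul0r.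
    have := cramer m.+2 y (fun q => (q == i)%:R).
    rewrite big_ord_recr /= yi.
    have -> : vdet m.+2 (y \o bump m.+2) = D0.
      apply: eq_vdet => p q pm _; rewrite /y /append_vec /=.
      have -> : bump m.+2 p = p by bump_lia.
      by rewrite pm.
    have -> : y m.+2 i = s (i + (j + m.+2))%N by rewrite /y /append_vec ltnn.
    rewrite (eq_bigr (fun p : 'I_m.+2 =>
      (-1) ^+ p * s (i + p)%N * psi p (j + m.+2)%N)); last first.
      move=> p _; rewrite yi; congr (_ * _).
        by rewrite /y /append_vec ltn_ord.
      apply: eq_vdet => a q am _; rewrite /y /append_vec /=; case: (ltnP a m.+1) => am'.
        by have -> : (bump p a < m.+2)%N by [bump_lia].
      by have pm := ltn_ord p; have -> : bump p a = m.+2 by [bump_lia]; rewrite ltnn.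
    set S := \sum_(_ < _) _ => E.
    under [in RHS]eq_bigr do rewrite mulrA.
    rewrite -mulr_suml -/S.
    have {E} -> : S = - ((-1) ^+ m.+2 * D0) * s (i + (j + m.+2))%N.
      by apply/eqP; rewrite -subr_eq0 -E; apply/eqP; rewrite /x; ring.
    by field; rewrite signr_eq0 D0_neq0 psi_neq0 // leq_addl.
  apply: cvgMl_tmp; apply: cvg_sumr => a; apply: cvgMl_tmp; exact: lP.
exists e; split=> //.
(* [psi 0] is linear and takes the value 1 on all the normalized vectors *)
have [c cE] := @vdet_append_lin m.+1 (x \o bump 0).
apply: contrapT => ne.
have e0 i : (i < m.+2)%N -> e i = 0.
  by move=> im; apply/eqP/negPn/negP => ei; apply: ne; exists i.
have : \sum_(i < m.+2) s (i + (j + m.+2))%N / psi 0%N (j + m.+2) * c i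
    @[j --> \oo] --> \sum_(i < m.+2) e i * c i.
  by apply: cvg_sumr => i; apply: cvgMr_tmp; apply: eP.
have : \sum_(i < m.+2) s (i + (j + m.+2))%N / psi 0%N (j + m.+2) * c i
    @[j --> \oo] --> (1 : R).
  apply: cvg_near_cst; apply: nearW => j.
  under eq_bigr do rewrite mulrAC.
  have sE : \sum_(i < m.+2) s (i + (j + m.+2))%N * c i = psi 0%N (j + m.+2)%N.
    by rewrite /psi cE.
  by rewrite -mulr_suml sE divff // psi_neq0 // leq_addl.
move=> c1 c2; have /eqP : (1 : R) = \sum_(i < m.+2) e i * c i.
  exact: (cvg_unique (@Rhausdorff R) c1 c2).
by rewrite big1 ?oner_eq0 // => i _; rewrite e0 ?mul0r.
Qed.

(** The limit [e] of the normalized windows is compatible with the shift: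
    [e (i + 1)] is [e i] times the limit [l] of the ratios [p (j+1) / p j] of the
    normalizing factors, which satisfy the same recurrence as [s].  So [e] is
    geometric, unless these ratios tend to infinity, or to [0]; both are
    excluded by the recurrence.  The inequality holds for a column
    [x j] with [j] large in place of the geometric vector, hence in the
    limit. *)
Lemma anchor_exists : eventually_recurrent s ->
  exists l et : R, [/\ 0 < l, et != 0 & forall h, incr m.+1 h ->
    0 <= et * vdet m.+2 (append_vec (x \o h) m.+1 (fun i => l ^+ i))].
Proof.
move=> rs; have [e [[i0 i0m ei0] eP]] := window_lim.
pose p j := psi 0%N (j + m.+2)%N.
have p0 j : p j != 0 by rewrite psi_neq0 // leq_addl.
have psgn j : 0 < p j.+1 / p j.
  have -> : p j.+1 / p j = p j.+1 * p j / p j ^+ 2 by field.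
  rewrite divr_gt0 //; last by rewrite exprn_even_gt0 ?p0 ?orbT.
  by apply: (same_sign (psi_gt0 _ _) (psi_gt0 _ _)) => //; rewrite leq_addl.
have rp : eventually_recurrent p.
  have [c cE] := @vdet_append_lin m.+1 (x \o bump 0).
  have -> : p = fun t => \sum_(i < m.+2) s (i + (t + m.+2))%N * c i.
    by apply/funext => t; rewrite /p /psi cE.
  exact: recurrent_comb.
have eP' i : (i < m.+2)%N -> s (i + (j.+1 + m.+2))%N / p j.+1 @[j --> \oo] --> e i.
  move=> im; have := eP i im; rewrite -(cvg_shiftn 1%N).
  by rewrite /=; under eq_cvg do rewrite addn1.
have link j i : p j.+1 / p j * (s (i + (j.+1 + m.+2))%N / p j.+1) =
    s (i.+1 + (j + m.+2))%N / p j.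
  by rewrite !addSn addnS; field; rewrite !p0.
(* if only the last entry of [e] is nonzero, the ratios tend to infinity *)
have [[i /andP[im ei]]|e0] := pselect (exists i, (i < m.+1)%N && (e i != 0)); last first.
  have e0' i : (i < m.+1)%N -> e i = 0.
    by move=> im; apply/eqP/negPn/negP => ei; apply: e0; exists i; rewrite im.
  have i0E : i0 = m.+1.
    apply/eqP; rewrite eqn_leq -ltnS i0m leqNgt; apply/negP => /e0'/eqP.
    by rewrite (negPf ei0).
  case: (recurrent_ratio_not_infty p0 rp).
  have := cvg_divr ei0 (eP' m (leqnSn _)) (eP i0 i0m).
  rewrite e0' // mul0r i0E; apply: cvg_near_eq.
  have := cvg_neq0 ei0 (eP i0 i0m); rewrite i0E; apply: filterS => j.
  rewrite /= -/(p j) -link; move: (s _ / _) => b.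
  rewrite mulf_eq0 => /norP[_ b0]; field; by rewrite b0 !p0.
set l := e i.+1 / e i.
have rl : p j.+1 / p j @[j --> \oo] --> l.
  have := cvg_divr ei (eP i.+1 im) (eP' i (ltnW im)).
  apply: cvg_near_eq.
  have := cvg_neq0 ei (eP' i (ltnW im)); apply: filterS => j sj.
  by rewrite /= -/(p j) -link mulfK.
have l0 : 0 < l.
  rewrite lt_def; apply/andP; split.
    by apply/eqP => l0; apply: (recurrent_ratio_not0 p0 rp); rewrite -l0.
  rewrite -(cvg_lim _ rl) //; apply: limr_ge; first by apply/cvg_ex; exists l.
  by apply: nearW => j; exact: ltW.
have eS q : (q < m.+1)%N -> e q.+1 = l * e q.
  move=> qm; have := cvg_mulr rl (eP' q (ltnW qm)).
  rewrite (_ : (fun n => _) = fun j => s (q.+1 + (j + m.+2))%N / p j); last first.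
    by apply/funext => j /=; rewrite link.
  by move=> c1; exact: (cvg_unique (@Rhausdorff R) (eP q.+1 qm) c1).
have eX q : (q < m.+2)%N -> e q = e 0%N * l ^+ q.
  elim: q => [|q IH] qm; first by rewrite mulr1.
  by rewrite eS // IH 1?ltnW // exprS mulrCA.
exists l, (e 0%N); split=> //.
  by apply: contra_neq ei => e0; rewrite eX 1?ltnW // e0 mul0r.
move=> h hi.
have [c cE] := @vdet_append_lin m.+1 (x \o h).
have lim : \sum_(i < m.+2) (s (i + (j + m.+2))%N / p j) * c i @[j --> \oo] -->
    e 0%N * vdet m.+2 (append_vec (x \o h) m.+1 (fun i => l ^+ i)).
  rewrite cE mulr_sumr; apply: cvg_sumr => q; rewrite mulrA -eX //.
  by apply: cvgMr_tmp; exact: eP.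
rewrite -(cvg_lim _ lim) //; apply: limr_ge; first by apply/cvg_ex; eexists; exact: lim.
near=> j.
under eq_bigr do rewrite mulrAC.
rewrite -mulr_suml.
have -> : \sum_(q < m.+2) s (q + (j + m.+2))%N * c q =
    vdet m.+2 (append_vec (x \o h) m.+1 (x (j + m.+2)%N)) by rewrite cE.
have -> : vdet m.+2 (append_vec (x \o h) m.+1 (x (j + m.+2)%N)) =
    hminor s m.+2 id (append_vec h m.+1 (j + m.+2)%N).
  by apply: eq_vdet => a b _ _; rewrite /append_vec /=; case: ifP.
set M := hminor _ _ _ _.
have -> : M / p j = M * p j / p j ^+ 2 by field.
rewrite divr_ge0 ?sqr_ge0 // ltW //.
apply: same_sign (psi_gt0 _ _) => //; last exact: leq_addl.
have hj : (h m < j)%N by near: j; exact: nbhs_infty_gt.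
apply: Hs => a b ab bm; rewrite /append_vec; case: (ltnP a m.+1) => am; last by lia.
case: (ltnP b m.+1) => bm'; first exact: hi.
by have := @incr_le m.+1 h a m hi ltac:(lia) ltac:(lia); lia.
Unshelve. all: by end_near.
Qed.

End AnchorExists.

(** * From the first rows to all rows *)

Section HankelPositivity.
Local Open Scope classical_set_scope.
Variable R : realType.
Implicit Types (k : nat) (s : nat -> R) (f h : nat -> nat).

Lemma hminor_scale (l : R) s k f h :
  hminor (fun t => l ^+ t * s t) k f h =
  (\prod_(j < k) l ^+ h j) * (\prod_(i < k) l ^+ f i) * hminor s k f h.
Proof.
rewrite -(@vdet_scale _ k (fun j => l ^+ h j) (fun i => l ^+ f i)).
by apply: eq_vdet => i j _ _; rewrite exprD [l ^+ f j * _]mulrC.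
Qed.

Lemma prod_expr_gt0 (l : R) k f : 0 < l -> 0 < \prod_(i < k) l ^+ f i.
Proof. by move=> l0; apply: prodr_gt0 => i _; exact: exprn_gt0. Qed.

(** Induction on [k], applied to the differences [d] of the rescaled sequence
    [G], for which the column at infinity is constant.  The induction
    hypothesis requires strict inequalities for the minors of [d] on the first
    rows.  They are available when column [0] is left out: this gives
    the strict inequalities, for [d] shifted by one.  For minors that involve
    column [0], it is applied to [d] plus a small multiple of its shift. *)
Theorem hminor_gt0_of_first_rows k s ep : eventually_recurrent s ->
  (forall h, incr k.+1 h -> 0 < ep * hminor s k.+1 id h) ->
  forall f h, incr k.+1 f -> incr k.+1 h -> 0 < ep * hminor s k.+1 f h.
Proof.
elim: k s ep => [|m IH] s ep rs Hs.
  move=> f h _ _; rewrite (_ : hminor s 1 f h = hminor s 1 id (fun j => f 0 + h j)%N).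
    by apply: Hs => i j; case: j => // j; rewrite ltnS => + /[!ltn0].
  by apply: eq_vdet => -[|i] [|j].
have [l [et [l0 et0 Hw]]] := anchor_exists Hs rs.
pose G t := (l^-1) ^+ t * s t.
have li0 : 0 < l^-1 by rewrite invr_gt0.
have scale k f h : exists2 c : R, 0 < c & hminor G k f h = c * hminor s k f h.
  exists ((\prod_(j < k) (l^-1) ^+ h j) * \prod_(i < k) (l^-1) ^+ f i).
    by rewrite mulr_gt0 // prod_expr_gt0.
  exact: hminor_scale.
suff HG : forall f h, incr m.+2 f -> incr m.+2 h -> 0 < ep * hminor G m.+2 f h.
  move=> f h fi hi; have [c c0 e] := scale m.+2 f h.
  by have := HG f h fi hi; rewrite e mulrCA pmulr_rgt0.
have HsG h : incr m.+2 h -> 0 < ep * hminor G m.+2 id h.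
  move=> hi; have [c c0 ->] := scale m.+2 id h.
  by rewrite mulrCA mulr_gt0 // Hs.
pose x j i := G (i + j)%N.
have HwG h : incr m.+1 h -> 0 <= et * vdet m.+2 (append_vec (x \o h) m.+1 (fun=> 1)).
  move=> hi.
  pose a j := if (j < m.+1)%N then (l^-1) ^+ h j else 1.
  rewrite (@eq_vdet _ _ _ (fun j i => a j * (l^-1) ^+ i * 
    append_vec (fun j i => s (i + h j)%N) m.+1 (fun i => l ^+ i) j i)); last first.
    move=> j i _ _; rewrite /a /append_vec /=; case: ifP => _.
      by rewrite /x /G exprD [l^-1 ^+ i * _]mulrC.
    by rewrite mul1r -exprMn mulVf ?expr1n // gt_eqF.
  rewrite vdet_scale mulrCA mulr_ge0 //; last exact: Hw.
  apply: ltW; rewrite mulr_gt0 //; last exact: (@prod_expr_gt0 _ _ id).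
  by apply: prodr_gt0 => j _; rewrite /a; case: ifP => // _; exact: exprn_gt0.
have HsG' h : incr m.+1 h -> (0 < h 0)%N ->
    0 < et * vdet m.+2 (append_vec (x \o h) m.+1 (fun=> 1)).
  by apply: (@vdet_append_weak_strict _ m.+1 x (fun=> 1) ep et) => //; exact: oner_neq0.
pose d t := G t.+1 - G t; pose et' := et * (-1) ^+ m.+1.
have dE h : et' * hminor d m.+1 id h = et * vdet m.+2 (append_vec (x \o h) m.+1 (fun=> 1)).
  by rewrite vdet_append_const1 mulrA.
have rG : eventually_recurrent G by apply: recurrent_scale => //; rewrite gt_eqF.
have rd : eventually_recurrent d.
  have -> : d = fun t => (-1) * G t + 1 * G t.+1.
    by apply/funext => t; rewrite mul1r mulN1r addrC.
  exact: recurrent_shift.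
apply: (@hminor_gt0_of_anchor _ m.+1 G ep et) => //= f h fi hi.
  apply: hminor_weak_limit => de de0; apply: IH => //.
    have -> : (fun t => d t + de * d t.+1) = fun t => 1 * d t + de * d t.+1.
      by apply/funext => t; rewrite mul1r.
    exact: recurrent_shift.
  apply: hminor_smooth => // h' h'i; first by rewrite dE; exact: HwG.
  by move=> h'0; rewrite dE; exact: HsG'.
move=> h0; pose h' i := (h i).-1; pose d1 t := d t.+1.
have hpos i : (i < m.+1)%N -> (0 < h i)%N.
  by move=> im; apply: leq_trans h0 _; have := @incr_le _ h 0 i hi (leq0n i) im; lia.
have -> : hminor d m.+1 f h = hminor d1 m.+1 f h'.
  by apply: eq_vdet => j i jm _; rewrite /d1 /h' -addnS prednK ?hpos.
apply: IH => //.
- have -> : d1 = fun t => 0 * d t + 1 * d t.+1.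
    by apply/funext => t; rewrite mul0r mul1r add0r.
  exact: recurrent_shift.
- move=> h1 h1i; have -> : hminor d1 m.+1 id h1 = hminor d m.+1 id (fun i => (h1 i).+1).
    by apply: eq_vdet => j i _ _; rewrite addnS.
  rewrite dE; apply: HsG' => // i j ij jm; rewrite ltnS; exact: h1i.
- move=> i j ij jm; have := hi i j ij jm; have := hpos i; rewrite /h'.
  by have := ltn_trans ij jm => im /(_ im); lia.
Qed.

End HankelPositivity.

(** * The Cauchy-Binet formula *)

Definition sorted_tuple n r (I : r.-tuple 'I_n) := sorted ltn (map val I).

Lemma sorted_tuple_inj n r (I : r.-tuple 'I_n) : sorted_tuple I -> injective (tnth I).
Proof.
move=> sI; apply/tuple_uniqP; apply: (@map_uniq _ _ val).
by apply: sorted_uniq sI; [exact: ltn_trans | exact: ltnn].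
Qed.

Lemma sorted_tuple_eq n r (I J : r.-tuple 'I_n) :
  sorted_tuple I -> sorted_tuple J -> I =i J -> I = J.
Proof.
move=> sI sJ IJ; apply: val_inj; apply: (@inj_map _ _ val val_inj).
apply: (@irr_sorted_eq _ ltn) => //; [exact: ltn_trans | exact: ltnn|].
move=> x; apply/mapP/mapP => -[i iI ->]; exists i => //; move: iI.
  by rewrite -[i \in val I]/(i \in I) IJ.
by rewrite -[i \in val J]/(i \in J) -IJ.
Qed.

Section CauchyBinet.
Variable R : comNzRingType.

Lemma det_row_mx_noninj d r n (U : 'M[R]_(d + r, d)) (X : 'M[R]_(d + r, n))
    (f : 'I_r -> 'I_n) : ~~ injectiveb f -> \det (row_mx U (colsub f X)) = 0.
Proof.
case/injectivePn => i [j ij e]; rewrite -det_tr.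
apply: (@determinant_alternate _ _ _ (rshift d i) (rshift d j)).
  by rewrite (inj_eq (@rshift_inj _ _)).
by move=> p; rewrite !mxE !(unsplitK (inr _)) !mxE e.
Qed.

Lemma det_row_mx_perm d r n (U : 'M[R]_(d + r, d)) (X : 'M[R]_(d + r, n))
    (f : 'I_r -> 'I_n) (s : 'S_r) :
  \det (row_mx U (colsub (f \o s) X)) = (-1) ^+ s * \det (row_mx U (colsub f X)).
Proof.
have -> : colsub (f \o s) X = colsub f X *m perm_mx s^-1.
  by rewrite -col_permE; apply/matrixP => i j; rewrite !mxE.
have -> : row_mx U (colsub f X *m perm_mx s^-1) =
    row_mx U (colsub f X) *m block_mx 1%:M 0 0 (perm_mx s^-1).
  by rewrite mul_row_block !mulmx1 !mulmx0 addr0 add0r.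
by rewrite det_mulmx det_ublock det1 mul1r det_perm odd_permV mulrC.
Qed.

Lemma det_row_mx_expand d r n (U : 'M[R]_(d + r, d)) (X : 'M[R]_(d + r, n))
    (Z : 'M[R]_(n, r)) :
  \det (row_mx U (X *m Z)) =
  \sum_(f : {ffun 'I_r -> 'I_n}) \det (row_mx U (colsub f X)) * \prod_j Z (f j) j.
Proof.
rewrite -det_tr.
transitivity (\sum_(s : 'S_(d + r)) \sum_(f : {ffun 'I_r -> 'I_n})
  (-1) ^+ s * \prod_i (row_mx U (colsub f X))^T i (s i) * \prod_j Z (f j) j).
  apply: eq_bigr => s _; rewrite big_split_ord /=.
  under [X in _ * (_ * X)]eq_bigr => j _ do
    rewrite mxE [row_mx _ _ _ _]mxE (unsplitK (inr _)) mxE.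
  rewrite bigA_distr_bigA /= mulrA mulr_sumr; apply: eq_bigr => f _.
  rewrite big_split_ord /= big_split /= !mulrA; congr (_ * _ * _ * _).
    by apply: eq_bigr => i _; rewrite !mxE !(unsplitK (inl _)).
  by apply: eq_bigr => j _; rewrite !mxE !(unsplitK (inr _)) mxE.
rewrite exchange_big /=; apply: eq_bigr => f _.
by rewrite -mulr_suml -[in RHS]det_tr.
Qed.

(** Each injective function is uniquely the composition of an increasing one and
    a permutation.  Uniqueness is proved directly, and existence follows from
    it by counting. *)
Lemma sum_inj_ffun n r (T : {ffun 'I_r -> 'I_n} -> R) :
  \sum_(f : {ffun 'I_r -> 'I_n} | injectiveb f) T f =
  \sum_(I : r.-tuple 'I_n | sorted_tuple I) \sum_(s : 'S_r) T [ffun j => tnth I (s j)].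
Proof.
pose S := [set p : r.-tuple 'I_n * 'S_r | sorted_tuple p.1]%SET.
pose F (p : r.-tuple 'I_n * 'S_r) : {ffun 'I_r -> 'I_n} := [ffun j => tnth p.1 (p.2 j)].
have Finj : {in S &, injective F}.
  move=> [I s] [J t]; rewrite !inE /= => sI sJ /ffunP e.
  have IJ : I = J.
    apply: sorted_tuple_eq => // x; apply/tnthP/tnthP => -[i ->].
      by exists (t (s^-1 i)%g); have := e (s^-1 i)%g; rewrite !ffunE permKV.
    by exists (s (t^-1 i)%g); have := e (t^-1 i)%g; rewrite !ffunE permKV.
  rewrite IJ in e *; congr (_, _); apply/permP => i.
  by have := e i; rewrite !ffunE /= => /(sorted_tuple_inj sJ).
have FS : F @: S = [set f : {ffun 'I_r -> 'I_n} | injectiveb f]%SET.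
  apply/eqP; rewrite eqEcard; apply/andP; split.
    apply/fintype.subsetP => f /imsetP[[I s]]; rewrite !inE /= => sI ->.
    apply/injectiveP => i j; rewrite !ffunE => /(sorted_tuple_inj sI).
    exact: perm_inj.
  rewrite card_in_imset // card_inj_ffuns !card_ord.
  have -> : S = finset.setX [set I : r.-tuple 'I_n | sorted_tuple I]%SET [set: 'S_r]%SET.
    by apply/setP => -[I s]; rewrite !inE andbT.
  by rewrite cardsX cardsT card_Sn card_ltn_sorted_tuples bin_ffact.
transitivity (\sum_(f in F @: S) T f); first by apply: eq_bigl => f; rewrite FS inE.
rewrite big_imset //= pair_big_dep /=; apply: eq_bigl => -[I s].
by rewrite !inE /= andbT.
Qed.

(** The presence of [U], untouched on both sides, makes the Laplace expansion of
    [row_mx U Z] an instance ([laplace_expand]). *)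
Lemma cauchy_binet_row d r n (U : 'M[R]_(d + r, d)) (X : 'M[R]_(d + r, n))
    (Z : 'M[R]_(n, r)) :
  \det (row_mx U (X *m Z)) = \sum_(I : r.-tuple 'I_n | sorted_tuple I)
    \det (row_mx U (colsub (tnth I) X)) * \det (rowsub (tnth I) Z).
Proof.
rewrite det_row_mx_expand (bigID (fun f : {ffun 'I_r -> 'I_n} => injectiveb f)).
rewrite /= [X in _ + X]big1 ?addr0.
  rewrite sum_inj_ffun; apply: eq_bigr => I _.
  rewrite -[X in _ = _ * X]det_tr mulr_sumr; apply: eq_bigr => s _.
  have -> : colsub [ffun j => tnth I (s j)] X = colsub (tnth I \o s) X.
    by apply/matrixP => p q; rewrite !mxE ffunE.
  rewrite det_row_mx_perm mulrCA mulrA; congr (_ * _).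
  by apply: eq_bigr => j _; rewrite ffunE !mxE.
by move=> f nf; rewrite det_row_mx_noninj ?mul0r.
Qed.

Lemma cauchy_binet r n (X : 'M[R]_(r, n)) (Z : 'M[R]_(n, r)) :
  \det (X *m Z) = \sum_(I : r.-tuple 'I_n | sorted_tuple I)
    \det (colsub (tnth I) X) * \det (rowsub (tnth I) Z).
Proof.
have := @cauchy_binet_row 0 r n (0 : 'M[R]_(r, 0)) X Z.
by rewrite row_thin_mx => ->; apply: eq_bigr => I _; rewrite row_thin_mx.
Qed.

End CauchyBinet.

Lemma index_tuple_inj n r : injective (@index_tuple n r).
Proof.
move=> i j; rewrite /index_tuple; set a := cast_ord _ i; set b := cast_ord _ j => e.
exact: cast_ord_inj (@Order.enum_val_inj _ _ _ a b e).
Qed.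

Lemma index_tuple_sorted n r (i : 'I_('C(n, r))) : sorted_tuple (index_tuple i).
Proof.
by have := Order.enum_valP (cast_ord (esym (card_incr_tuples n r)) i); rewrite inE.
Qed.

Lemma index_tuple_imset n r :
  (@index_tuple n r) @: [set: 'I_('C(n, r))]%SET =
  [set I : r.-tuple 'I_n | sorted_tuple I]%SET.
Proof.
apply/eqP; rewrite eqEcard; apply/andP; split.
  by apply/fintype.subsetP => I /imsetP[i _ ->]; rewrite inE index_tuple_sorted.
rewrite card_imset ?cardsT ?card_ord ?card_ltn_sorted_tuples //.
exact: index_tuple_inj.
Qed.

Lemma index_tuple_surj n r (I : r.-tuple 'I_n) : sorted_tuple I ->
  exists i, index_tuple i = I.
Proof.
move=> sI; have : I \in [set I : r.-tuple 'I_n | sorted_tuple I]%SET by rewrite inE.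
by rewrite -index_tuple_imset => /imsetP[i _ ->]; exists i.
Qed.

Lemma sum_index_tuple (V : nmodType) n r (F : r.-tuple 'I_n -> V) :
  \sum_(i < 'C(n, r)) F (index_tuple i) = \sum_(I | sorted_tuple I) F I.
Proof.
transitivity (\sum_(I in (@index_tuple n r) @: [set: 'I_('C(n, r))]%SET) F I).
  rewrite big_imset /=; first by apply: eq_bigl => i; rewrite inE.
  by move=> i j _ _; exact: index_tuple_inj.
by apply: eq_bigl => I; rewrite index_tuple_imset inE.
Qed.

(** * The Laplace expansion *)

Section Laplace.
Variable R : realType.

Lemma vdet_last_delta m (v : nat -> nat -> R) p0 : (p0 < m.+1)%N ->
  (forall p, (p < m.+1)%N -> v m p = (p == p0)%:R) ->
  vdet m.+1 v = (-1) ^+ (m + p0) * vdet m (fun q p => v q (bump p0 p)).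
Proof.
move=> pm vm; rewrite /vdet (expand_det_row _ ord_max) (bigD1 (Ordinal pm)) //= big1.
  rewrite addr0 mxE vm // eqxx mul1r /cofactor /=; congr (_ * \det _).
  by apply/matrixP => i j; rewrite !mxE /= [bump m i]bumpE leqNgt ltn_ord.
by move=> p; rewrite -val_eqE /= mxE => pp0; rewrite vm ?ltn_ord // (negPf pp0) mul0r.
Qed.

Variables (n : nat) (i0 : 'I_n) (yy : 'I_n -> nat -> R) (d : nat).
Implicit Types I J : seq 'I_n.

(** The entries of [laplace_mx], for sequences: their size then need not be
    written as [m - r], and induction on them is possible. *)
Definition laplace_term I J : R :=
  if all (mem I) J then
    let D := [seq s <- I | s \notin J] in
    let eps := (\sum_(s <- D) (index s I).+1 + (d * d.+1) %/ 2)%N in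
    (-1) ^+ eps * \det (rows_of D (\matrix_(i < n, j < d) yy i j))
  else 0.

Lemma sum_succ_index (T : eqType) (s : seq T) : uniq s ->
  (\sum_(x <- s) (index x s).+1 = (size s * (size s).+1) %/ 2)%N.
Proof.
case: s => [|x0 s'] us; first by rewrite big_nil.
move: (x0 :: s') us => s us.
rewrite (big_nth x0) (eq_big_nat _ _ (F2 := fun i => i.+1)); last first.
  by move=> i /andP[_ im]; rewrite index_uniq.
elim: (size s) => [|m IH]; first by rewrite big_nil.
by rewrite big_nat_recr //= IH addnC -divnMDl //; congr (_ %/ _)%N; lia.
Qed.

(** Induction on [J], removing its largest element [j]: the last vector of the
    determinant is the unit vector of the row of [j].  All elements of [I]
    beyond [j] belong to the difference of [I] and [J], and the positions of
    exactly these decrease by one when [j] is removed; this accounts for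
    the sign of the expansion. *)
Lemma vdet_laplace J I : pairwise (relpre val ltn) I -> pairwise (relpre val ltn) J ->
  size I = (d + size J)%N ->
  vdet (d + size J) (fun q p => if (q < d)%N then yy (nth i0 I p) q
     else (nth i0 I p == nth i0 J (q - d))%:R) = laplace_term I J.
Proof.
have lt_irr : irreflexive (relpre (@nat_of_ord n) ltn) by move=> x /=; rewrite ltnn.
have uniqP s : pairwise (relpre (@nat_of_ord n) ltn) s -> uniq s.
  by apply: pairwise_uniq.
elim/last_ind: J I => [|J j IH] I pI pJ sI.
  rewrite /laplace_term /= filter_predT addn0 in sI *.
  have uI := uniqP _ pI.
  (* for [J] empty, the two parts of the exponent are equal triangular numbers *)
  rewrite sum_succ_index // sI -signr_odd addnn odd_double mul1r.
  rewrite /vdet -det_tr; congr (\det _); apply/matrixP => p q; rewrite !mxE ltn_ord.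
  by rewrite (nth_map i0) ?sI // mxE.
rewrite size_rcons addnS in sI *.
have [jI|jI] := boolP (j \in I); last first.
  have -> : laplace_term I (rcons J j) = 0.
    by rewrite /laplace_term all_rcons -[mem I j]/(j \in I) (negPf jI).
  rewrite /vdet (expand_det_row _ ord_max) big1 // => p _; rewrite !mxE /=.
  rewrite ltnNge leq_addr /= addKn nth_rcons ltnn eqxx.
  case: eqP => [e|_]; last by rewrite mul0r.
  by case/negP: jI; rewrite -e mem_nth // sI ltn_ord.
case/splitPr: jI pI sI => I1 I2 pI sI.
have uI := uniqP _ pI.
have jE : nth i0 (I1 ++ j :: I2) (size I1) = j by rewrite nth_cat ltnn subnn.
set v := fun q p => _.
have szI : (d + size J = size I1 + size I2)%N.
  by move: sI; rewrite size_cat /= addnS => -[].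
rewrite (@vdet_last_delta _ v (size I1)); first last.
- move=> p pm; rewrite /v ltnNge leq_addr /= addKn nth_rcons ltnn eqxx.
  by rewrite -[X in _ == X]jE nth_uniq // size_cat /= addnS -szI // ltnS szI leq_addr.
- by rewrite ltnS szI leq_addr.
have eI p : nth i0 (I1 ++ j :: I2) (bump (size I1) p) = nth i0 (I1 ++ I2) p.
  rewrite !nth_cat bumpE; have [pI1|pI1] := ltnP p (size I1).
    by rewrite pI1.
  by rewrite ltnNge (leqW pI1) /= subSn.
rewrite (@eq_vdet _ _ _ (fun q p => if (q < d)%N then yy (nth i0 (I1 ++ I2) p) q
     else (nth i0 (I1 ++ I2) p == nth i0 J (q - d))%:R)); last first.
  move=> q p qm pm; rewrite /v eI; case: ltnP => // dq.
  by rewrite nth_rcons; have -> : (q - d < size J)%N by lia.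
move: pI; rewrite pairwise_cat pairwise_cons => /and3P[pI12 pI1 /andP[pj pI2]].
move: pJ; rewrite pairwise_rcons => /andP[Jj pJ].
rewrite IH //; first last.
- by rewrite size_cat -szI.
- rewrite pairwise_cat pI1 pI2 andbT; move: pI12.
  by rewrite allrel_consr andbT => /andP[].
have jJ : j \notin J.
  by apply/negP => /(allP Jj) /=; rewrite ltnn.
have I2J x : x \in I2 -> x \notin rcons J j.
  move=> /(allP pj) /= jx; rewrite mem_rcons inE negb_or; apply/andP; split.
    by apply: contraTneq jx => ->; rewrite ltnn.
  by apply/negP => /(allP Jj) /=; rewrite ltnNge (ltnW jx).
move: (uI); rewrite cat_uniq /= negb_or => /and3P[_ /andP[jI1 I12] /andP[jI2 _]].
have jmem : mem (I1 ++ j :: I2) j.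
  by rewrite -[mem _ j]/(j \in _) mem_cat inE eqxx orbT.
rewrite /laplace_term [in RHS]all_rcons jmem andTb.
have -> : all (mem (I1 ++ j :: I2)) J = all (mem (I1 ++ I2)) J.
  apply: eq_in_all => x xJ; rewrite -![mem _ x]/(x \in _) !mem_cat inE.
  by have -> : (x == j) = false by [apply: contraNF jJ => /eqP <-].
case: ifP => _; last by rewrite mulr0.
pose D1 := [seq s <- I1 | s \notin J].
have -> : [seq s <- I1 ++ I2 | s \notin J] = D1 ++ I2.
  rewrite filter_cat; congr (_ ++ _); apply/all_filterP/allP => x /I2J.
  by rewrite mem_rcons inE negb_or => /andP[].
have -> : [seq s <- I1 ++ j :: I2 | s \notin rcons J j] = D1 ++ I2.
  rewrite filter_cat /= mem_rcons inE eqxx /=; congr (_ ++ _).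
    apply: eq_in_filter => x xI1; rewrite mem_rcons inE negb_or.
    by have -> : x != j by apply: contraNneq jI1 => <-.
  by apply/all_filterP/allP => x /I2J.
rewrite /= !big_cat /= mulrA; congr (_ * _).
have -> : (\sum_(s <- D1) (index s (I1 ++ j :: I2)).+1 =
           \sum_(s <- D1) (index s (I1 ++ I2)).+1)%N.
  rewrite big_seq [RHS]big_seq; apply: eq_bigr => x.
  by rewrite mem_filter => /andP[_ xI1]; rewrite !index_cat xI1.
have -> : (\sum_(s <- I2) (index s (I1 ++ j :: I2)).+1 =
           \sum_(s <- I2) (index s (I1 ++ I2)).+1 + size I2)%N.
  rewrite -sum1_size -big_split /= big_seq [RHS]big_seq; apply: eq_bigr => x xI2.
  have xI1 : x \notin I1 by apply: contraNN I12 => xI1; apply/hasP; exists x.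
  have xj : (j == x) = false by apply: contraNF jI2 => /eqP ->.
  by rewrite !index_cat (negPf xI1) /= xj addn1 addnS.
rewrite -exprD szI -signr_odd -[RHS]signr_odd; congr (_ ^+ (nat_of_bool _)).
rewrite !oddD; move: (odd _) (odd _) (odd _) (odd _) (odd _) => a b c e f.
by case: a; case: b; case: c; case: e; case: f.
Qed.

End Laplace.

(** * Responses of the compound systems *)

Section CompoundSystem.
Variable R : realType.

(** The entry of a compound with a single row or column refers to the only
    increasing tuple there is. *)
Lemma sorted_tuple_full r (I : r.-tuple 'I_r) p : sorted_tuple I -> tnth I p = p.
Proof.
move=> sI; suff -> : I = ord_tuple r by rewrite tnth_ord_tuple.
apply: sorted_tuple_eq => //.
  by change (sorted ltn (map val (enum 'I_r))); rewrite val_enum_ord iota_ltn_sorted.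
move=> x; have -> : x \in ord_tuple r.
  by apply/tnthP; exists x; rewrite tnth_ord_tuple.
apply/tnthP.
by exists (invF (sorted_tuple_inj sI) x); rewrite f_invF.
Qed.

Lemma sorted_tuple_pairwise n r (I : r.-tuple 'I_n) :
  sorted_tuple I -> pairwise (relpre val ltn) I.
Proof.
by rewrite /sorted_tuple sorted_map sorted_pairwise // => x y z /=; exact: ltn_trans.
Qed.

Lemma compound_mul r n m l (X : 'M[R]_(n, m)) (Z : 'M[R]_(m, l)) :
  compound r (X *m Z) = compound r X *m compound r Z.
Proof.
apply/matrixP => i j; rewrite !mxE.
have -> : mxsub (tnth (index_tuple i)) (tnth (index_tuple j)) (X *m Z) =
    rowsub (tnth (index_tuple i)) X *m colsub (tnth (index_tuple j)) Z.
  by apply/matrixP => p q; rewrite !mxE; apply: eq_bigr => o _; rewrite !mxE.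
rewrite cauchy_binet -sum_index_tuple; apply: eq_bigr => o _; rewrite !mxE.
by congr (_ * _); congr (\det _); apply/matrixP => p q; rewrite !mxE.
Qed.

(** Write [Z], restricted to the rows in [I], as [X *m Z] where the rows of [X]
    are unit vectors, and apply [cauchy_binet_row]. *)
Lemma laplace_expand n (i0 : 'I_n) (yy zz : 'I_n -> nat -> R) d r (I : seq 'I_n) :
  pairwise (relpre val ltn) I -> size I = (d + r)%N ->
  \sum_(J : r.-tuple 'I_n | sorted_tuple J)
     laplace_term yy d I J * vdet r (fun q p => zz (nth i0 J p) q) =
  vdet (d + r) (fun q p => if (q < d)%N then yy (nth i0 I p) q
                         else zz (nth i0 I p) (q - d)%N).
Proof.
move=> pI sI.
pose U := \matrix_(p < d + r, q < d) yy (nth i0 I p) q.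
pose X := \matrix_(p < d + r, l < n) (nth i0 I p == l)%:R : 'M[R]_(d + r, n).
pose Z := \matrix_(l < n, q < r) zz l q.
transitivity (\det (row_mx U (X *m Z))); last first.
  rewrite -vdet_tr; congr (\det _); apply/matrixP => p q; rewrite !mxE.
  case: splitP => q' ->; first by rewrite mxE.
  rewrite mxE addKn (bigD1 (nth i0 I p)) //= !mxE eqxx mul1r.
  by rewrite big1 ?addr0 // => l; rewrite mxE eq_sym => /negPf ->; rewrite mul0r.
rewrite cauchy_binet_row; apply: eq_bigr => J sJ; congr (_ * _).
  have := @vdet_laplace R n i0 yy d J I pI (sorted_tuple_pairwise sJ).
  rewrite size_tuple => /(_ sI) <-.
  rewrite -vdet_tr; congr (\det _); apply/matrixP => p q; rewrite !mxE.
  case: splitP => q' ->; first by rewrite mxE.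
  by rewrite !mxE addKn (tnth_nth i0).
rewrite -vdet_tr; congr (\det _); apply/matrixP => p q; rewrite !mxE.
by rewrite (tnth_nth i0).
Qed.

Variables (n : nat) (A : 'M[R]_n) (b : 'cV[R]_n) (c : 'rV[R]_n) (i0 : 'I_n).

Let krylov (i : 'I_n) (j : nat) : R := (A ^+ j *m b) i 0.

Lemma compound_pow_ctrl r t :
  compound r A ^+ t *m castmx (erefl, binn r) (compound r (ctrl_mx r A b)) =
  castmx (erefl, binn r) (compound r (\matrix_(i, j) krylov i (t + j))).
Proof.
elim: t => [|t IH].
  by rewrite expr0 mul1mx; congr (castmx _ (compound r _)).
rewrite exprS -[_ * _]/(_ *m _) -mulmxA IH.
apply/matrixP => i j; rewrite [RHS]castmxE [LHS]mxE /=.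
have -> : \matrix_(i < n, j < r) krylov i (t.+1 + j) = A *m \matrix_(i, j) krylov i (t + j).
  apply/matrixP => p q; rewrite !mxE /krylov addSn exprS -[A * _]/(A *m _) -mulmxA mxE.
  by apply: eq_bigr => l _; rewrite !mxE.
by rewrite compound_mul mxE; apply: eq_bigr => l _; rewrite castmxE /= ?cast_ord_id.
Qed.

Lemma compound_state k r t (j : 'I_('C(n, r))) :
  (compound r A ^+ t *m compound_sys_b A b k r) j 0 =
  vdet r (fun q p => krylov (nth i0 (index_tuple j) p) (t + (k - r) + q)).
Proof.
rewrite /compound_sys_b mulmxA -[_ *m _ ^+ _]/(_ * _) -exprD compound_pow_ctrl.
rewrite castmxE mxE -vdet_tr; congr (\det _).
apply/matrixP => p q; rewrite !mxE cast_ord_id.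
by rewrite (tnth_nth i0) sorted_tuple_full // index_tuple_sorted.
Qed.

Lemma laplace_state k r t (i : 'I_('C(n, k))) : (r <= k)%N ->
  (laplace_mx (ctrl_mx (k - r) A b) *m
     (compound r A ^+ t *m compound_sys_b A b k r)) i 0 =
  vdet k (fun q p => krylov (nth i0 (index_tuple i) p) (shift_from (k - r) t q)).
Proof.
move=> rk; rewrite mxE; under eq_bigr do rewrite compound_state mxE.
have [e|ne] := eqVneq r k.
  subst r; rewrite (bigD1 i) //= eqxx mul1r big1 ?addr0 => [|j].
    by apply: eq_vdet => q p _ _; rewrite subnn addn0 /shift_from leq0n addnC.
  by rewrite -val_eqE eq_sym => /negPf /= ->; rewrite mul0r.
transitivity (\sum_(J : r.-tuple 'I_n | sorted_tuple J)
   laplace_term krylov (k - r) (index_tuple i) J *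
   vdet r (fun q p => krylov (nth i0 J p) (t + (k - r) + q))).
  by rewrite -sum_index_tuple.
rewrite (@laplace_expand n i0 krylov (fun i q => krylov i (t + (k - r) + q))).
- rewrite subnK //; apply: eq_vdet => q p _ _; rewrite /shift_from.
  by case: (ltnP q (k - r)) => //= dq; congr krylov; lia.
- exact/sorted_tuple_pairwise/index_tuple_sorted.
- by rewrite size_tuple subnK.
Qed.

(** The three factors of the response are expanded by the Laplace and
    Cauchy-Binet formulas into one determinant, whose entries are those of the
    observability matrix times the columns [A^q b], with [q] in the initial run
    or in the shifted run of columns. *)
Lemma compound_sys_response k r t : (r <= k)%N ->
  impulse_response (compound r A) (compound_sys_b A b k r)
    (compound_sys_c A b c k r) t.+1 =
  Num.sg (\det (hankel_mx (impulse_response A b c) 1 k k)) *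
  hminor (fun t => (c *m A ^+ t *m b) 0 0) k id (shift_from (k - r) t).
Proof.
move=> rk; rewrite /impulse_response /compound_sys_c -!scalemxAl mxE -!mulmxA.
congr (_ * _); rewrite mxE.
under eq_bigr do rewrite laplace_state // castmxE mxE.
pose Ob := obs_mx k A c; pose W := \matrix_(l < n, q < k) krylov l (shift_from (k - r) t q).
transitivity (\det (Ob *m W)).
  rewrite cauchy_binet -sum_index_tuple; apply: eq_bigr => i _; congr (_ * _).
    congr (\det _); apply/matrixP => p q; rewrite !mxE cast_ord_id.
    by rewrite sorted_tuple_full // index_tuple_sorted.
  rewrite -vdet_tr; congr (\det _); apply/matrixP => p q; rewrite !mxE.
  by rewrite (tnth_nth i0).
rewrite /hminor -vdet_tr; congr (\det _); apply/matrixP => p q; rewrite [RHS]mxE.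
have -> : c *m A ^+ (p + shift_from (k - r) t q) *m b =
    (c *m A ^+ p) *m (A ^+ shift_from (k - r) t q *m b).
  by rewrite exprD -[_ * _]/(_ *m _) !mulmxA.
by rewrite [LHS]mxE [RHS]mxE; apply: eq_bigr => l _; rewrite [Ob _ _]mxE [W _ _]mxE.
Qed.

End CompoundSystem.

(** * Strict sign consistency *)

Section SignConsistency.
Variable R : realType.

Definition all_minors_same_sign (s : nat -> R) k := forall f h,
  incr k f -> incr k h -> 0 < hminor s k id id * hminor s k f h.

Lemma incr_sorted_tuple N k (i0 : 'I_N) (I : k.-tuple 'I_N) : sorted_tuple I ->
  incr k (fun p => nth i0 I p).
Proof.
move=> sI i j ij jk; have ik := ltn_trans ij jk.
rewrite -!(nth_map i0 0%N val) ?size_tuple //.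
by rewrite (sorted_ltn_nth ltn_trans) // inE size_map size_tuple.
Qed.

Lemma sorted_tuple_incr N k (f : nat -> nat) : incr k f ->
  (forall p, (p < k)%N -> (f p < N)%N) ->
  exists2 I : k.-tuple 'I_N, sorted_tuple I & forall p, tnth I p = f p :> nat.
Proof.
move=> fi fN; exists (mktuple (fun p : 'I_k => Ordinal (fN p (ltn_ord p)))).
  apply/(sortedP 0%N) => i; rewrite size_map size_tuple => ik.
  have ik' := ltnW ik.
  rewrite !(nth_map (Ordinal (fN i ik'))) ?size_tuple //.
  rewrite -[i]/(nat_of_ord (Ordinal ik')) -[(Ordinal ik').+1]/(nat_of_ord (Ordinal ik)).
  by rewrite -!tnth_nth !tnth_mktuple /=; apply: fi.
by move=> p; rewrite tnth_mktuple.
Qed.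

Lemma compound_hankel (g : nat -> R) N k (i j : 'I_('C(N, k))) (f h : nat -> nat) :
  (forall p, tnth (index_tuple i) p = f p :> nat) ->
  (forall p, tnth (index_tuple j) p = h p :> nat) ->
  compound k (hankel_mx g 1 N N) i j = hminor (fun t => g t.+1) k f h.
Proof.
move=> fE hE; rewrite mxE /hminor -vdet_tr; congr (\det _).
by apply/matrixP => p q; rewrite !mxE fE hE.
Qed.

(** The sign may a priori depend on the size of the truncation; it does not,
    since all truncations share the leading minor. *)
Lemma hankel_op_strictly_sign_consistentP k (g : nat -> R) : (0 < k)%N ->
  hankel_op_strictly_sign_consistent k g <->
  all_minors_same_sign (fun t => g t.+1) k.
Proof.
move=> k0; split=> [H f h fi hi|H N kN].
  pose N := (k + f k.-1 + h k.-1).+1.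
  have kN : (k <= N)%N by lia.
  have bound f' : incr k f' -> (f' k.-1 < N)%N ->
      forall p, (p < k)%N -> (f' p < N)%N.
    move=> f'i f'N p pk; have := @incr_le k f' p k.-1 f'i ltac:(lia) ltac:(lia); lia.
  have idi : incr k id by [].
  have [J1 sJ1 J1E] := sorted_tuple_incr fi (bound _ fi ltac:(lia)).
  have [J2 sJ2 J2E] := sorted_tuple_incr hi (bound _ hi ltac:(lia)).
  have [I0 sI0 I0E] := sorted_tuple_incr idi (bound _ idi ltac:(lia)).
  have [i ei] := index_tuple_surj sJ1; have [j ej] := index_tuple_surj sJ2.
  have [l el] := index_tuple_surj sI0.
  have [dl _ pos] := H N kN.
  apply: (@same_sign _ dl).
    by have := pos l l; rewrite mxE (@compound_hankel _ _ _ _ _ id id) ?el.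
  by have := pos i j; rewrite mxE (@compound_hankel _ _ _ _ _ f h) ?ei ?ej.
have D0 : hminor (fun t => g t.+1) k id id != 0.
  have := gt_eqF (H id id (fun _ _ ij _ => ij) (fun _ _ ij _ => ij)).
  by rewrite mulf_eq0 => /norP[].
exists (Num.sg (hminor (fun t => g t.+1) k id id)).
  rewrite !inE; have := sgr_cp0 (hminor (fun t => g t.+1) k id id).
  by case: sgrP D0 => //; rewrite ?eqxx ?orbT.
have N0 : (0 < N)%N by exact: leq_trans kN.
move=> i j; pose i0 := Ordinal N0.
rewrite mxE (@compound_hankel _ _ _ _ _ (fun p => nth i0 (index_tuple i) p)
  (fun p => nth i0 (index_tuple j) p)); try by move=> p; rewrite (tnth_nth i0).
have := H _ _ (incr_sorted_tuple i0 (index_tuple_sorted i))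
  (incr_sorted_tuple i0 (index_tuple_sorted j)).
set D := hminor _ _ _ _ in D0 *.
by rewrite {1}[D]numEsg -mulrA mulrCA pmulr_rgt0 // normr_gt0.
Qed.

End SignConsistency.

(** By the Cayley-Hamilton theorem, after dividing the characteristic polynomial
    by the largest possible power of the variable. *)
Lemma recurrent_response (R : realType) n (A : 'M[R]_n) (b : 'cV[R]_n) (c : 'rV[R]_n) :
  (0 < n)%N -> eventually_recurrent (fun t => (c *m A ^+ t *m b) 0 0).
Proof.
case: n A b c => // n A b c _.
have [m [q /implyP q0 pE]] := multiplicity_XsubC (char_poly A) 0.
have {}q0 : ~~ root q 0 by apply: q0; exact/monic_neq0/char_poly_monic.
have qn0 : q != 0 by apply: contraNneq q0 => ->; exact: root0.
have szq : (size q).-1.+1 = size q by rewrite prednK // lt0n size_poly_eq0.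
exists (fun i => q`_i), (size q).-1, m; split.
- by move: q0; rewrite rootE horner_coef0.
- by rewrite -lead_coefE lead_coef_eq0.
move=> t mt; rewrite szq.
have CH : horner_mx A q *m A ^+ m = 0.
  have := Cayley_Hamilton A; rewrite pE subr0 rmorphM rmorphXn /= horner_mx_X.
  by [].
have qA : horner_mx A q = \sum_(i < size q) q`_i *: A ^+ i.
  rewrite -[in LHS](coefK q) poly_def rmorph_sum /=; apply: eq_bigr => i _.
  by rewrite horner_mxZ rmorphXn /= horner_mx_X.
transitivity ((c *m (horner_mx A q *m A ^+ m) *m A ^+ (t - m) *m b) 0 0); last first.
  by rewrite CH mulmx0 !mul0mx mxE.
rewrite qA mulmx_suml mulmx_sumr !mulmx_suml summxE; apply: eq_bigr => i _.
have -> : A ^+ (t + i) = A ^+ i *m A ^+ m *m A ^+ (t - m).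
  by rewrite -![_ *m _]/(_ * _) -!exprD; congr (_ ^+ _); lia.
by rewrite -!scalemxAl -!scalemxAr -!scalemxAl [RHS]mxE !mulmxA.
Qed.

(** The compound systems see exactly the minors of [vdet_gt0_of_shift_from]. *)
Theorem sign_consistent_compound (R : realType) n (A : 'M[R]_n) (b : 'cV[R]_n)
    (c : 'rV[R]_n) k : (0 < k <= n)%N ->
  all_minors_same_sign (fun t => (c *m A ^+ t *m b) 0 0) k <->
  (forall r : nat, (1 <= r <= k)%N ->
     strictly_externally_positive (compound r A)
       (compound_sys_b A b k r) (compound_sys_c A b c k r)).
Proof.
move=> /andP[k0 kn]; have n0 : (0 < n)%N by exact: leq_trans kn.
set s := fun t => _; pose i0 := Ordinal n0.
have DE : \det (hankel_mx (impulse_response A b c) 1 k k) = hminor s k id id.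
  by rewrite /hminor -vdet_tr; congr (\det _); apply/matrixP => p q; rewrite !mxE.
have shift_fromP s0 t : incr k (shift_from s0 t).
  by move=> i j ij jk; rewrite /shift_from; case: (leqP s0 i); case: (leqP s0 j); lia.
split=> [H r /andP[r0 rk] [//|t] _|H].
  rewrite (compound_sys_response _ _ _ i0) // DE.
  have := H id (shift_from (k - r) t) (fun _ _ ij _ => ij) (shift_fromP _ _).
  set D := hminor s k id id; have [->|D0] := eqVneq D 0; first by rewrite mul0r ltxx.
  by rewrite {1}[D]numEsg -mulrA mulrCA pmulr_rgt0 // normr_gt0.
have Hrect s0 t : (s0 < k)%N -> 0 < Num.sg (hminor s k id id) * hminor s k id (shift_from s0 t).
  move=> sk; have := H (k - s0)%N ltac:(lia) t.+1 isT.
  rewrite (compound_sys_response _ _ _ i0) ?leq_subr // DE.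
  by have -> : (k - (k - s0) = s0)%N by lia.
have Hcols h : incr k h -> 0 < Num.sg (hminor s k id id) * hminor s k id h.
  exact: (@vdet_gt0_of_shift_from _ k (fun j i => s (i + j)%N) _ k0 Hrect).
case: k k0 kn {DE shift_fromP Hrect} H Hcols => // k _ kn H Hcols f h fi hi.
have rs := @recurrent_response R n A b c n0.
have Hall := hminor_gt0_of_first_rows rs Hcols.
by apply: same_sign (Hall _ _ _ _) (Hall _ _ fi hi).
Qed.

(** * Alternations of signs *)

Section Alternation.
Local Open Scope classical_set_scope.
Variable R : realType.
Implicit Types (u v y : nat -> R) (f : nat -> nat) (k : nat).

(** Positions of strictly alternating signs, [sg] giving the sign at the first of
    them. *)
Definition alternates k u := exists f (sg : R),
  incr k.+1 f /\ forall p, (p <= k)%N -> 0 < sg * (-1) ^+ p * u (f p).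

(** The zero entries can be given any sign, so that [sg] has to be nonzero to
    make this meaningful. *)
Definition weakly_alternates k y := exists f (sg : R),
  [/\ sg != 0, incr k.+1 f & forall p, (p <= k)%N -> 0 <= sg * (-1) ^+ p * y (f p)].

Definition opp_step u : rel nat := fun i j => (i < j)%N && (u i * u j < 0).

(** Alternations can be built step by step, as paths. *)
Lemma path_alternates k u a w : (0 < k)%N -> path (opp_step u) a w -> (k <= size w)%N ->
  alternates k u.
Proof.
move=> k0 pw kw.
pose f p := nth 0%N (a :: w) p.
have step p : (p < size w)%N -> (f p < f p.+1)%N && (u (f p) * u (f p.+1) < 0).
  by move=> pw'; have /(pathP 0%N)/(_ p pw') := pw.
exists f, (u (f 0%N)); split.
  move=> i j ij jk; elim: j => // j IH in ij jk *.
  have /andP[lt _] := step j ltac:(lia).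
  rewrite ltnS leq_eqVlt in ij; case/orP: ij => [/eqP ->//|ij].
  by apply: ltn_trans lt; apply: IH; lia.
have u0 : u (f 0%N) != 0.
  have /andP[_] := step 0%N ltac:(lia).
  by apply: contraTneq => ->; rewrite mul0r ltxx.
elim=> [|p IH] pk.
  by rewrite expr0 mulr1 -expr2 exprn_even_gt0.
have /andP[_ neg] := step p ltac:(lia).
have IHp := IH (ltnW pk).
have up : 0 < u (f p) ^+ 2.
  by rewrite exprn_even_gt0 //=; apply: contraTneq neg => ->; rewrite mul0r ltxx.
rewrite -(pmulr_rgt0 _ up) [(-1) ^+ p.+1]exprS.
have -> : u (f p) ^+ 2 * (u (f 0%N) * (-1 * (-1) ^+ p) * u (f p.+1)) =
  (u (f 0%N) * (-1) ^+ p * u (f p)) * - (u (f p) * u (f p.+1)) by ring.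
by rewrite mulr_gt0 // oppr_gt0.
Qed.

Lemma alternates_neq0 k u : alternates k u -> u <> cst 0.
Proof.
move=> [f [sg [_ H]]] u0; have := H 0%N isT.
by rewrite u0 /= mulr0 ltxx.
Qed.

Lemma mulr_lt0_same_sign (x y z : R) : 0 < x * y -> x * z < 0 -> y * z < 0.
Proof.
move=> xy xz; rewrite -(pmulr_rlt0 _ xy).
have -> : x * y * (y * z) = y ^+ 2 * (x * z) by ring.
rewrite pmulr_rlt0 // exprn_even_gt0 //=.
by apply: contraTneq xy => ->; rewrite mulr0 ltxx.
Qed.

(** If a nonzero entry lies in between, its sign is opposite to one of the two
    given ones. *)
Lemma sign_change_between u (x y : nat) : (x < y)%N -> u x * u y < 0 ->
  exists a b, [/\ (x <= a)%N, (a < b)%N, (b <= y)%N & sign_changes u (a, b)].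
Proof.
have [n] := ubnP (y - x)%N; elim: n => // n IH in x y *; rewrite ltnS => nxy xy neg.
have [[l [/andP[xl ly] ul]]|no] :=
  pselect (exists l, (x < l < y)%N /\ u l != 0); last first.
  exists x, y; split=> //; split=> //= l lxy; apply/eqP/negPn/negP => ul.
  by apply: no; exists l.
have [xl0|xl0] := ltP (u x * u l) 0.
  have [a [b [xa ab bl ab']]] := IH x l ltac:(lia) xl xl0.
  by exists a, b; split=> //; lia.
have ly0 : u l * u y < 0.
  apply: mulr_lt0_same_sign (neg); rewrite lt_def xl0 andbT mulf_neq0 //.
  by apply: contraTneq neg => ->; rewrite mul0r ltxx.
have [a [b [xa ab bl ab']]] := IH l y ltac:(lia) ly ly0.
by exists a, b; split=> //; lia.
Qed.

(** The intervals between consecutive positions of an alternation contain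
    different sign changes. *)
Lemma alternates_counting k u : (0 < k)%N -> alternates k u ->
  ~ (counting (sign_changes u) <= (k.-1)%:R%:E :> \bar R)%E.
Proof.
move=> k0 [f [sg [fi H]]]; rewrite /counting; case: asboolP => // fin.
have [F FP] : exists F : nat -> nat * nat, forall i, (i < k)%N ->
    [/\ (f i <= (F i).1)%N, ((F i).1 < f i.+1)%N & sign_changes u (F i)].
  apply: (@finite_choice _ (0%N, 0%N) k (fun i ab =>
    [/\ (f i <= ab.1)%N, (ab.1 < f i.+1)%N & sign_changes u ab])) => i ik.
  have neg : u (f i) * u (f i.+1) < 0.
    have h1 := H i (ltnW ik); have h2 := H i.+1 ik.
    rewrite exprS mulN1r in h2; rewrite -oppr_gt0 -mulrN.
    by apply: (@same_sign _ (sg * (-1) ^+ i)) => //; move: h2; rewrite mulrN !mulNr mulrN.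
  have [a [b [fa ab bf ab']]] := sign_change_between (fi _ _ (ltnSn i) ik) neg.
  by exists (a, b); split=> //=; exact: leq_trans bf.
have Finj : injective (fun i : 'I_k => F i).
  have lt i j : (i < j)%N -> (j < k)%N -> ((F i).1 < (F j).1)%N.
    move=> ij jk; have [_ a _] := FP i ltac:(lia); have [b _ _] := FP j jk.
    apply: leq_trans a (leq_trans _ b).
    by have := @incr_le k.+1 f i.+1 j fi ij ltac:(lia); lia.
  move=> i j e; apply: val_inj => /=.
  case: (ltngtP i j) => // ij.
    by have := lt _ _ ij (ltn_ord j); rewrite e ltnn.
  by have := lt _ _ ij (ltn_ord i); rewrite e ltnn.
rewrite lee_fin ler_nat leqNgt; apply/negP; rewrite negbK.
pose B := [fset F (val i) | i in 'I_k]%fset.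
have cB : #|` B| = k by rewrite card_imfset //= -cardE card_ord.
rewrite prednK // -[X in (X <= _)%N]cB; apply: fsubset_leq_card.
apply/fsubsetP => _ /imfsetP[i _ ->]; rewrite in_fset_set //; apply/mem_set.
by have [] := FP i (ltn_ord i).
Qed.

(** Going through the sign changes from right to left: at a sign change at [a],
    followed by one at [a'], prepend [a] to the path starting at [a'] if
    the signs there are opposite, and else [a] and the position that follows
    [a] in the sign change. *)
Lemma sign_changes_path u (a : nat) (l : seq nat) : path ltn a l ->
  (forall x : nat, x \in a :: l -> exists b, sign_changes u (x, b)) ->
  exists2 w, path (opp_step u) a w & (size (a :: l) <= size w)%N.
Proof.
elim: l a => [|a' l IH] a /= => [_|/andP[aa' pl]] Q.
  have [b [/= ab _ neg]] := Q a (mem_head _ _).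
  by exists [:: b] => //=; rewrite /opp_step ab neg.
have [w pw sw] : exists2 w, path (opp_step u) a' w & (size (a' :: l) <= size w)%N.
  by apply: IH => // x xl; apply: Q; rewrite inE xl orbT.
have [b [/= ab z neg]] := Q a (mem_head _ _).
have [b' [/= _ _ neg']] := Q a' ltac:(by rewrite !inE eqxx orbT).
have ua : u a != 0 by apply: contraTneq neg => ->; rewrite mul0r ltxx.
have ua' : u a' != 0 by apply: contraTneq neg' => ->; rewrite mul0r ltxx.
have ba' : (b <= a')%N.
  rewrite leqNgt; apply/negP => a'b; move/eqP: ua'; apply.
  by apply: z; rewrite aa'.
have [opp|same] := ltP (u a * u a') 0.
  by exists (a' :: w) => //=; rewrite /opp_step aa' opp.
have {}same : 0 < u a * u a' by rewrite lt_def same mulf_neq0.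
have ab' : u b * u a' < 0 by rewrite mulrC (mulr_lt0_same_sign same).
have ltb : (b < a')%N.
  rewrite ltn_neqAle ba' andbT; apply: contraTneq ab' => ->.
  by rewrite -leNgt -expr2 sqr_ge0.
exists [:: b, a' & w]; first by rewrite /= /opp_step ab neg ltb ab'.
by rewrite /=; apply: leqW.
Qed.

Lemma alternates_of_counting k u : (0 < k)%N ->
  ~ (counting (sign_changes u) <= (k.-1)%:R%:E :> \bar R)%E -> alternates k u.
Proof.
move=> k0 nle.
have [B Bsub Bk] : exists2 B : {fset nat * nat},
    [set` B] `<=` sign_changes u & (k <= #|` B|)%N.
  move: nle; rewrite /counting; case: asboolP => [fin|inf] nle.
    exists (fset_set (sign_changes u)); first by rewrite fset_setK.
    by move: nle; rewrite lee_fin ler_nat => /negP; rewrite -ltnNge; lia.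
  by have [B Bs Bk] := infinite_set_fset k inf; exists B.
have fst_inj : {in B &, injective fst}.
  move=> [a b] [a' b'] /Bsub/= [/= ab z n] /Bsub/= [/= ab' z' n'] /= e; subst a'.
  congr (_, _); case: (ltngtP b b') => // bb.
    by move: n; rewrite /= (z' b) ?ab // mulr0 ltxx.
  by move: n'; rewrite /= (z b') ?ab' // mulr0 ltxx.
pose l := sort leq [seq p.1 | p <- enum_fset B].
have ll : sorted ltn l.
  rewrite ltn_sorted_uniq_leq sort_uniq map_inj_in_uniq ?fset_uniq //=.
  exact: (sort_sorted leq_total).
have sl : (k <= size l)%N by rewrite size_sort size_map.
have lQ x : x \in l -> exists b, sign_changes u (x, b).
  by rewrite mem_sort => /mapP[[a b] /Bsub/= ab ->]; exists b.
case: l ll sl lQ => [|a l] //= ll sl lQ; first by lia.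
have [w pw sw] := sign_changes_path ll lQ.
by apply: path_alternates pw _ => //; exact: leq_trans sw.
Qed.

Lemma Sminus_le k u : (0 < k)%N ->
  (Sminus u <= (k.-1)%:R%:E)%E <-> ~ alternates k u.
Proof.
move=> k0; rewrite /Sminus; case: eqP => [u0|u0].
  split=> [_ /alternates_neq0 //|_]; rewrite lee_fin.
  by apply: le_trans (ler0n _ _); rewrite oppr_le0.
split=> [le alt|nalt]; first exact: alternates_counting alt le.
by apply: contrapT => /(alternates_of_counting k0).
Qed.

(** From a weak alternation, one obtains a sequence that alternates strictly by
    choosing the values of the zero entries on its positions. *)
Lemma Splus_le k y : (0 < k)%N ->
  (Splus y <= (k.-1)%:R%:E)%E <-> ~ weakly_alternates k y.
Proof.
move=> k0; split=> [le [f [sg [sg0 fi H]]]|nalt].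
  pose v t := if y t != 0 then y t else sg * (-1) ^+ index t [seq f p | p <- iota 0 k.+1].
  have vE p : (p <= k)%N -> index (f p) [seq f p | p <- iota 0 k.+1] = p.
    move=> pk; rewrite -[f p](_ : nth 0%N [seq f p | p <- iota 0 k.+1] p = _); last first.
      by rewrite (nth_map 0%N) ?size_iota // nth_iota.
    rewrite index_uniq ?size_map ?size_iota //.
    rewrite map_inj_in_uniq ?iota_uniq // => i j.
    rewrite !mem_iota !add0n /= => ik jk e.
    by case: (ltngtP i j) => // ij; have := fi _ _ ij ltac:(lia); lia.
  have : (Sminus v <= (k.-1)%:R%:E)%E.
    apply: le_trans le; apply: ereal_sup_ubound; exists v => // i /= yi.
    by rewrite /v yi.
  move/(Sminus_le _ k0); apply; exists f, sg; split=> // p pk.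
  rewrite /v; case: ifPn => [yp|_].
    by rewrite lt_def H // mulf_neq0 // mulf_neq0 ?signr_eq0.
  rewrite vE // mulrACA -expr2 -expr2 mulr_gt0 // exprn_even_gt0 //= ?signr_eq0 //.
apply: ge_ereal_sup => _ [v vE <-]; apply/(Sminus_le _ k0) => -[f [sg [fi H]]].
apply: nalt; exists f, sg; split=> // [|p pk].
  by have := H 0%N isT; apply: contraTneq => ->; rewrite !mul0r ltxx.
have [->|yp] := eqVneq (y (f p)) 0; first by rewrite mulr0.
by rewrite -(vE _ yp); apply/ltW/H.
Qed.

End Alternation.

(** * From variation bounding to sign consistency *)

Section Variation.
Local Open Scope classical_set_scope.
Variable R : realType.
Implicit Types (g u y : nat -> R) (f h : nat -> nat) (k : nat).

Lemma strictly_variation_boundingP k g : (0 < k)%N ->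
  strictly_variation_bounding k.-1 (hankel_dom g) (hankel_op g) <->
  (forall u, hankel_dom g u -> u <> cst 0 -> ~ alternates k u ->
     ~ weakly_alternates k (hankel_op g u)).
Proof.
move=> k0; split=> H u du u0 Hu.
  by apply/(Splus_le _ k0); apply: H => //; apply/(Sminus_le _ k0).
by apply/(Splus_le _ k0); apply: H => //; apply/(Sminus_le _ k0).
Qed.

Section FiniteInput.
Variables (g : nat -> R) (k : nat) (h : nat -> nat) (a : nat -> R).
Hypothesis hi : incr k h.

Definition sparse_input : nat -> R := fun t => \sum_(q < k) (t == h q)%:R * a q.

Lemma sparse_input_on q : (q < k)%N -> sparse_input (h q) = a q.
Proof.
move=> qk; rewrite /sparse_input (bigD1 (Ordinal qk)) //= eqxx mul1r big1 ?addr0 //.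
move=> p pq; have -> : (h q == h p) = false; last by rewrite mul0r.
apply/eqP => e; move: pq; rewrite -val_eqE /=; case: (ltngtP p q) => // pq _.
  by have := hi pq qk; rewrite e ltnn.
by have := hi pq (ltn_ord p); rewrite e ltnn.
Qed.

Lemma sparse_input_off t : (forall q, (q < k)%N -> t != h q) -> sparse_input t = 0.
Proof.
move=> th; rewrite /sparse_input big1 // => q _.
by rewrite (negPf (th _ (ltn_ord q))) mul0r.
Qed.

Lemma hankel_series_sparse t N : (forall q, (q < k)%N -> (h q < N)%N) ->
  hankel_series g sparse_input t N = \sum_(q < k) a q * g (t + h q).+1.
Proof.
move=> hN; rewrite /hankel_series /series /=.
under eq_bigr do rewrite mulr_sumr.
rewrite exchange_big /=; apply: eq_bigr => q _.
rewrite big_mkord (bigD1 (Ordinal (hN q (ltn_ord q)))) //= eqxx mul1r big1.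
  by rewrite addr0 mulrC addnS.
by move=> j; rewrite -val_eqE /= => /negPf ->; rewrite mul0r mulr0.
Qed.

Lemma hankel_series_sparse_cvg t :
  hankel_series g sparse_input t n @[n --> \oo] --> \sum_(q < k) a q * g (t + h q).+1.
Proof.
apply: cvg_near_cst; near=> N; apply: hankel_series_sparse => q qk.
have hq : (h q <= h k.-1)%N.
  by have := @incr_le k h q k.-1 hi ltac:(lia) ltac:(lia); lia.
apply: leq_ltn_trans hq _; near: N; exact: nbhs_infty_gt.
Unshelve. all: by end_near. Qed.

Lemma hankel_dom_sparse : hankel_dom g sparse_input.
Proof. by move=> t; apply/cvg_ex; eexists; exact: hankel_series_sparse_cvg. Qed.

Lemma hankel_op_sparse t :
  hankel_op g sparse_input t = \sum_(q < k) a q * g (t + h q).+1.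
Proof. by apply/cvg_lim => //; exact: hankel_series_sparse_cvg. Qed.

(** An alternation along [k + 1] positions needs [k + 1] nonzero entries. *)
Lemma sparse_input_not_alternates : ~ alternates k sparse_input.
Proof.
move=> [f [sg [fi H]]].
have [q qP] : exists q : nat -> nat,
    forall p, (p < k.+1)%N -> (q p < k)%N /\ f p = h (q p).
  apply: (@finite_choice nat 0%N k.+1 (fun p q => (q < k)%N /\ f p = h q)) => p pk.
  apply: contrapT => no; have := H p pk; rewrite sparse_input_off ?mulr0 ?ltxx //.
  by move=> q qk; apply/eqP => e; apply: no; exists q.
have qi : incr k.+1 q.
  move=> i j ij jk; have ik := ltn_trans ij jk.
  have [qik fE] := qP i ik; have [qjk fE'] := qP j jk.
  have := fi i j ij jk; rewrite fE fE' ltnNge [in X in _ -> X]ltnNge.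
  apply: contraNN => qji.
  by have := @incr_le k h (q j) (q i) hi qji qik; lia.
have := @incr_le k.+1 q 0 k qi (leq0n k) (ltnSn k); have [] := qP k (ltnSn k); lia.
Qed.

End FiniteInput.

Section BoundingToConsistent.
Variables (g : nat -> R) (k : nat).
Hypothesis k0 : (0 < k)%N.
Hypothesis H : forall u, hankel_dom g u -> u <> cst 0 -> ~ alternates k u ->
  ~ weakly_alternates k (hankel_op g u).

Let s t := g t.+1.

Let hminorE f h : hminor s k f h = vdet k (fun p q => s (f p + h q)%N).
Proof. by rewrite hminor_sym; apply: eq_vdet => i j _ _; rewrite addnC. Qed.

Let no_alternation h (a : nat -> R) : incr k h -> (exists2 q, (q < k)%N & a q != 0) ->
  ~ weakly_alternates k (fun t => \sum_(q < k) a q * s (t + h q)%N).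
Proof.
move=> hi [q qk aq].
have -> : (fun t => \sum_(q < k) a q * s (t + h q)%N) = hankel_op g (sparse_input k h a).
  by apply/funext => t; rewrite hankel_op_sparse.
apply: H; [exact: hankel_dom_sparse | | exact: sparse_input_not_alternates].
move=> /(congr1 (fun u => u (h q))); rewrite sparse_input_on // => /eqP.
by rewrite (negPf aq).
Qed.

(** A vector in the kernel of the submatrix is an input, whose output vanishes
    in the [k] rows of [f]; together with one more row, this is a weak
    alternation. *)
Lemma minor_neq0 f h : incr k f -> incr k h -> hminor s k f h != 0.
Proof.
move=> fi hi; apply/eqP; rewrite hminor_sym hminorE => /eqP/det0P[v v0 vM].
have [q vq] : exists q, v 0 q != 0.
  by apply: contrapT => no; case/negP: v0; apply/eqP/matrixP => i q; rewrite ord1 mxE;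
    apply/eqP/negPn/negP => vq; apply: no; exists q.
pose a (q : nat) := if insub q is Some q' then v 0 q' else 0.
have aE (q' : 'I_k) : a q' = v 0 q' by rewrite /a valK.
apply: (@no_alternation h a hi); first by exists q; rewrite // aE.
pose y t := \sum_(q < k) a q * s (t + h q)%N.
have y0 p : (p < k)%N -> y (f p) = 0.
  move=> pk; move/matrixP/(_ 0 (Ordinal pk)): vM; rewrite !mxE => e; rewrite -[RHS]e.
  by apply: eq_bigr => q' _; rewrite !mxE aE addnC.
(* one row after those of [f]; [sg] makes the sign at that row right *)
pose f' p := if (p < k)%N then f p else (f k.-1).+1.
pose sg : R := if 0 <= (-1) ^+ k * y (f' k) then 1 else -1.
exists f', sg; split.
- by rewrite /sg; case: ifP; rewrite ?oppr_eq0 oner_eq0.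
- move=> i j ij jk; rewrite /f'; case: (ltnP i k) => ik; case: (ltnP j k) => jk'; try lia.
    exact: fi.
  by have := @incr_le k f i k.-1 fi ltac:(lia) ltac:(lia); lia.
move=> p pk; rewrite -[X in _ * X]/(y (f' p)).
move: pk; rewrite leq_eqVlt => /orP[/eqP ->|pk]; last first.
  by rewrite /f' pk y0 // mulr0.
rewrite -mulrA /sg; case: ifP; first by rewrite mul1r.
by move/negbT; rewrite -ltNge mulN1r oppr_ge0; exact: ltW.
Qed.

(** The cofactors of the row in which the two minors differ form an input, whose
    output is zero in the common rows and takes the two
    minors as its values in rows [K i.+1] and [K i].  If these had opposite
    signs, the output would alternate weakly along [K]. *)
Lemma minor_adjacent K h i : incr k.+1 K -> incr k h -> (i < k)%N ->
  0 < hminor s k (K \o bump i) h * hminor s k (K \o bump i.+1) h.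
Proof.
move=> Ki hi ik; have n1 := minor_neq0 (incr_bump i Ki) hi.
have n2 := minor_neq0 (incr_bump i.+1 Ki) hi.
rewrite lt_def mulf_neq0 //= leNgt; apply/negP => neg.
pose r p q := s (K p + h q)%N.
have [a aE] := vdet_set_vec (r \o bump i) ik.
pose y t := \sum_(q < k) a q * s (t + h q)%N.
have yE p : y (K p) = vdet k (set_vec (r \o bump i) i (r p)).
  by rewrite aE; apply: eq_bigr => q _; rewrite mulrC.
have y1 : y (K i.+1) = hminor s k (K \o bump i) h.
  rewrite yE hminorE; apply: eq_vdet => p q _ _; rewrite /set_vec /=; case: eqP => // ->.
  by have -> : bump i i = i.+1 by bump_lia.
have y2 : y (K i) = hminor s k (K \o bump i.+1) h.
  rewrite yE hminorE; apply: eq_vdet => p q _ _; rewrite /set_vec /=; case: eqP => [->|pi].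
    by have -> : bump i.+1 i = i by bump_lia.
  by have -> : bump i.+1 p = bump i p by bump_lia.
have y0 p : (p < k.+1)%N -> p != i -> p != i.+1 -> y (K p) = 0.
  move=> pk pi pi1; rewrite yE.
  pose p' := if (p < i)%N then p else p.-1.
  have p'i : p' != i by rewrite /p'; case: (ltnP p i); lia.
  have p'k : (p' < k)%N by rewrite /p'; case: (ltnP p i); lia.
  have bp : bump i p' = p by rewrite /p'; case: (ltnP p i) => ?; bump_lia.
  have eqv l : set_vec (r \o bump i) i (r p) p' l = set_vec (r \o bump i) i (r p) i l.
    by rewrite /set_vec eqxx (negPf p'i) /= bp.
  case: (ltngtP p' i) p'i => // lt _.
    by apply: (@vdet_alt _ _ _ p' i); rewrite ?lt.
  by apply: (@vdet_alt _ _ _ i p'); rewrite ?lt // => l _; rewrite eqv.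
apply: (@no_alternation h a hi).
  apply: contrapT => no; case/eqP: n1; rewrite -y1 /y big1 // => q _.
  have [->|aq] := eqVneq (a q) 0; first by rewrite mul0r.
  by case: no; exists q.
pose sg := (-1) ^+ i * y (K i).
exists K, sg; split=> //.
  by rewrite /sg y2 mulf_neq0 ?signr_eq0.
move=> p pk; rewrite -[X in _ * X]/(y (K p)); have [->|pi] := eqVneq p i.
  have -> : sg * (-1) ^+ i * y (K i) = sg ^+ 2 by rewrite /sg; ring.
  exact: sqr_ge0.
have [->|pi1] := eqVneq p i.+1.
  rewrite /sg exprS.
  have -> : (-1) ^+ i * y (K i) * (-1 * (-1) ^+ i) * y (K i.+1) =
     ((-1) ^+ i) ^+ 2 * - (y (K i.+1) * y (K i)) by ring.
  by rewrite sqrr_sign mul1r oppr_ge0 y1 y2 ltW.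
by rewrite y0 // mulr0.
Qed.

(** The rows [f i] are moved to the positions [i] one after the other,
    beginning with the first one. *)
Lemma minor_sign_rows f h : incr k f -> incr k h ->
  0 < hminor s k id h * hminor s k f h.
Proof.
move=> fi hi.
pose F m i := if (i < m)%N then i else f i.
suff main : forall m, (m <= k)%N -> 0 < hminor s k (F m) h * hminor s k f h.
  have := main k (leqnn k); congr (0 < _ * _); apply: eq_hminor => // i ik.
  by rewrite /F ik.
have fge i : (i < k)%N -> (i <= f i)%N.
  by move=> ik; have := @incr_le k f 0 i fi (leq0n i) ik; lia.
have Fi m : (m <= k)%N -> incr k (F m).
  move=> mk i j ij jk; rewrite /F.
  case: (ltnP i m) => im; case: (ltnP j m) => jm; try lia.
    by apply: leq_trans (fge j jk); lia.
  exact: fi.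
elim=> [|m IH] mk.
  by have := minor_neq0 fi hi; rewrite lt_def -expr2 sqr_ge0 andbT sqrf_eq0.
have {}IH := IH (ltnW mk).
have [e|ne] := eqVneq (f m) m.
  move: IH; congr (0 < _ * _); apply: eq_hminor => // i ik; rewrite /F ltnS.
  by case: ltngtP => // ->.
pose K j := if (j <= m)%N then j else f j.-1.
have Kinc : incr k.+1 K.
  move=> i j ij jk; rewrite /K; case: (leqP i m) => im; case: (leqP j m) => jm; try lia.
    have [jm1|jm1] := eqVneq j m.+1.
      by rewrite jm1 /=; have := fge m mk; lia.
    by have := fge j.-1 ltac:(lia); lia.
  by apply: fi; lia.
have adj := minor_adjacent Kinc hi mk.
have e1 : hminor s k (K \o bump m) h = hminor s k (F m) h.
  apply: eq_hminor => // i ik; rewrite /K /F /=.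
  case: (ltnP i m) => im.
    by have -> : bump m i = i by [bump_lia]; rewrite ltnW.
  by have -> : bump m i = i.+1 by [bump_lia]; rewrite ltnNge im.
have e2 : hminor s k (K \o bump m.+1) h = hminor s k (F m.+1) h.
  apply: eq_hminor => // i ik; rewrite /K /F /= ltnS.
  case: (leqP i m) => im.
    by have -> : bump m.+1 i = i by [bump_lia]; rewrite im.
  by have -> : bump m.+1 i = i.+1 by [bump_lia]; rewrite ltnNge ltnW.
rewrite e1 e2 in adj.
by apply: (@same_sign _ (hminor s k (F m) h)).
Qed.

(** The rows are treated by [minor_sign_rows], and the columns by symmetry. *)
Theorem bounding_all_minors : all_minors_same_sign s k.
Proof.
move=> f h fi hi; have idi : incr k id by [].
apply: (@same_sign _ (hminor s k id h)); last exact: minor_sign_rows.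
by rewrite mulrC [X in _ * X]hminor_sym; exact: minor_sign_rows.
Qed.

End BoundingToConsistent.

End Variation.

(** * From sign consistency to variation bounding *)

Section ConsistentToBounding.
Local Open Scope classical_set_scope.
Variable R : realType.
Implicit Types (g u y : nat -> R) (f h : nat -> nat) (k : nat).

Lemma constant_sign u (P : nat -> Prop) :
  (forall i j, P i -> P j -> (i < j)%N -> ~~ (u i * u j < 0)) ->
  exists2 sg : R, sg ^+ 2 = 1 & forall t, P t -> 0 <= sg * u t.
Proof.
move=> H; have [[t [Pt ut]]|no] := pselect (exists t, P t /\ u t < 0).
  exists (-1); first by rewrite sqrrN expr1n.
  move=> i Pi; rewrite mulN1r oppr_ge0 leNgt; apply/negP => ui.
  have neg : u i * u t < 0 by rewrite pmulr_rlt0.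
  case: (ltngtP i t) => it.
  - by have := H i t Pi Pt it; rewrite neg.
  - by have := H t i Pt Pi it; rewrite mulrC neg.
  - by move: ui; rewrite it ltNge ltW.
exists 1; first by rewrite expr1n.
by move=> i Pi; rewrite mul1r leNgt; apply/negP => ui; apply: no; exists i.
Qed.

(** Greedy choice: each interval ends right before the first sign that is opposite
    to some sign in it.  An alternating path in the remaining part can then be
    prolonged to the left, so that its bound decreases.  If no interval ends
    before infinity, a single position is cut off, because exactly [k + 1]
    intervals are wanted. *)
Lemma sign_blocks u k s :
  (forall a w, (s <= a)%N -> path (opp_step u) a w -> (size w <= k)%N) ->
  exists (c : nat -> nat) (sg : nat -> R),
    [/\ c 0%N = s, incr k.+1 c, forall j, sg j ^+ 2 = 1 &
     forall j t, (j <= k)%N -> (c j <= t)%N -> ((j < k)%N -> (t < c j.+1)%N) ->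
       0 <= sg j * u t].
Proof.
elim: k s => [|k IH] s Hs.
  have [sg sg2 sgP] : exists2 sg : R, sg ^+ 2 = 1 & forall t, (s <= t)%N -> 0 <= sg * u t.
    apply: (@constant_sign u (fun t => (s <= t)%N)) => i j si sj ij; apply/negP => neg.
    by have := Hs i [:: j] si; rewrite /= /opp_step ij neg => /(_ isT).
  exists (fun=> s), (fun=> sg); split=> //.
    by move=> i j; case: j => // j _; rewrite ltnS ltn0.
  by move=> j t _ st _; exact: sgP.
have [s' [ss' s'const Hs']] : exists s', [/\ (s < s')%N,
    forall i j, (s <= i)%N -> (i < j)%N -> (j < s')%N -> ~~ (u i * u j < 0) &
    forall a w, (s' <= a)%N -> path (opp_step u) a w -> (size w <= k)%N].
  pose Q (l : nat) := [exists x : 'I_l, (s <= x)%N && (u x * u l < 0)].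
  have [exQ|noQ] := pselect (exists l, Q l); last first.
    exists s.+1; split=> // [i j si ij js|a w sa pw]; first by lia.
    case: w pw => // x w /= /andP[/andP[ax neg] _].
    by case: noQ; exists x; apply/existsP; exists (Ordinal ax); rewrite /= neg andbT; lia.
  case: (ex_minnP exQ) => s' /existsP[x /andP[sx neg]] s'min.
  exists s'; split; first by have := ltn_ord x; lia.
    move=> i j si ij js; apply/negP => neg'.
    have /s'min : Q j by apply/existsP; exists (Ordinal ij); rewrite /= si neg'.
    by rewrite leqNgt js.
  move=> a w sa pw.
  have [opp|same] := ltP (u x * u a) 0.
    have := Hs x (a :: w) sx; rewrite /= /opp_step opp pw !andbT.
    by apply; exact: leq_trans (ltn_ord x) sa.
  case: w pw => // y w /= /andP[/andP[ay neg2] pw].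
  have ua : u a != 0 by apply: contraTneq neg2 => ->; rewrite mul0r ltxx.
  have ux : u x != 0 by apply: contraTneq neg => ->; rewrite mul0r ltxx.
  have {}same : 0 < u x * u a by rewrite lt_def same mulf_neq0.
  have opp : u s' * u a < 0 by rewrite mulrC (mulr_lt0_same_sign same).
  have s'a : (s' < a)%N.
    rewrite ltn_neqAle sa andbT; apply: contraTneq opp => ->.
    by rewrite -leNgt -expr2 sqr_ge0.
  have := Hs x [:: s', a, y & w] sx.
  by rewrite /= /opp_step neg opp s'a ltn_ord ay neg2 pw => /(_ isT); lia.
have [c [sg [c0 ci sg2 cP]]] := IH s' Hs'.
have [sg0 sg02 sg0P] : exists2 sg : R, sg ^+ 2 = 1 &
    forall t, (s <= t < s')%N -> 0 <= sg * u t.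
  apply: (@constant_sign u (fun t => (s <= t < s')%N)) => i j /andP[si _] /andP[_ js] ij.
  exact: s'const.
exists (fun j => if j is j'.+1 then c j' else s),
  (fun j => if j is j'.+1 then sg j' else sg0).
split=> //.
- move=> [|i] [|j] // ij jk; last exact: ci.
  apply: leq_trans ss' _; rewrite -c0; case: j ij jk => // j _ jk.
  by apply: ltnW; apply: ci.
- by case.
- move=> [|j] t jk ct tc; last by apply: cP.
  by apply: sg0P; rewrite ct; have := tc isT; rewrite c0.
Qed.

Lemma exists_block (c : nat -> nat) k t : (c 0 <= t < c k)%N ->
  exists2 j, (j < k)%N & (c j <= t < c j.+1)%N.
Proof.
elim: k => [|k IH] /andP[c0t tck]; first by lia.
have [ckt|tc] := leqP (c k) t; first by exists k; rewrite // ckt.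
by have [|j jk Bj] := IH; [rewrite c0t | exists j => //; exact: ltnW].
Qed.

Lemma sum_blocks (F : nat -> R) (c : nat -> nat) k : incr k.+1 c ->
  \sum_(c 0%N <= t < c k) F t = \sum_(j < k) \sum_(c j <= t < c j.+1) F t.
Proof.
elim: k => [|k IH] ci; first by rewrite big_geq // big_ord0.
rewrite big_ord_recr /= -IH; last by apply: incrW ci.
rewrite (@big_cat_nat _ _ _ (c k)) //=; last by apply: ltnW; apply: ci.
by have := @incr_le _ c 0 k ci (leq0n k) (ltnW (ltnSn _)); lia.
Qed.

Lemma cone_comp (S : (nat -> R) -> Prop) (z : nat -> R) (e : nat -> nat) :
  cone S z -> cone (fun w => exists2 w', S w' & w = w' \o e) (z \o e).
Proof.
elim=> [a w {}z a0 Sw zE|w w' {}z _ Cw _ Cw' zE].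
  by apply: (@cone_gen _ _ a (w \o e)) => // [|i]; [exists w | rewrite /= zE].
by apply: (cone_add Cw Cw') => i; rewrite /= zE.
Qed.

(** The determinant is linear in the last vector, and thus the limit of sums of
    positive multiples of positive numbers; it is at least the term with index
    [t0]. *)
Lemma vdet_tail_gt0 k (V x : nat -> nat -> R) (T a : nat -> R) (ep : R) c0 t0 :
  (forall t, (c0 <= t)%N -> 0 < ep * vdet k.+1 (set_vec V k (x t))) ->
  (forall t, 0 <= a t) -> (c0 <= t0)%N -> 0 < a t0 ->
  (forall i, (i < k.+1)%N -> \sum_(c0 <= t < n) a t * x t i @[n --> \oo] --> T i) ->
  0 < ep * vdet k.+1 (set_vec V k T).
Proof.
move=> H a0 ct0 at0 TP.
have [C CE] := vdet_set_vec V (ltnSn k).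
have lim : \sum_(c0 <= t < n) a t * (ep * vdet k.+1 (set_vec V k (x t))) @[n --> \oo] -->
    ep * vdet k.+1 (set_vec V k T).
  have -> : (fun n => \sum_(c0 <= t < n) a t * (ep * vdet k.+1 (set_vec V k (x t)))) =
      (fun n => ep * \sum_(i < k.+1) (\sum_(c0 <= t < n) a t * x t i) * C i).
    apply/funext => n; under [in RHS]eq_bigr do rewrite mulr_suml.
    rewrite exchange_big /= mulr_sumr; apply: eq_bigr => t _.
    rewrite mulrCA CE; congr (_ * _); rewrite mulr_sumr; apply: eq_bigr => i _.
    by rewrite mulrA.
  rewrite CE; apply: cvgMl_tmp; apply: cvg_sumr => i; apply: cvgMr_tmp.
  exact: TP.
apply: (@lt_le_trans _ _ (a t0 * (ep * vdet k.+1 (set_vec V k (x t0))))).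
  by rewrite mulr_gt0 // H.
rewrite -(cvg_lim _ lim) //; apply: limr_ge; first by apply/cvg_ex; eexists; exact: lim.
near=> n.
have t0n : (t0 < n)%N by near: n; exact: nbhs_infty_gt.
rewrite (bigD1_seq t0) ?mem_index_iota ?ct0 ?iota_uniq //= lerDl.
rewrite big_nat_cond; apply: sumr_ge0 => t /andP[/andP[ct _] _].
by rewrite mulr_ge0 // ltW // H.
Unshelve. all: by end_near. Qed.

Variables (g : nat -> R) (k : nat).
Let s t := g t.+1.

Hypothesis SC : all_minors_same_sign s k.+1.

(** In the linear dependence between the [k + 2] rows of [W], given by its
    maximal minors, all terms of the combination would have the same sign, and
    hence vanish.  So [W] would kill [a], although its minors are not zero. *)
Lemma no_weak_alternation (W : nat -> nat -> R) (a : nat -> R) (ep sg : R) :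
  (forall i, (i <= k.+1)%N -> 0 < ep * vdet k.+1 (fun j p => W j (bump i p))) ->
  (exists2 j, (j < k.+1)%N & a j != 0) -> sg != 0 ->
  ~ (forall p, (p <= k.+1)%N -> 0 <= sg * (-1) ^+ p * \sum_(j < k.+1) a j * W j p).
Proof.
move=> Wpos [j0 j0k aj0] sg0 alt.
pose y p := \sum_(j < k.+1) a j * W j p.
have := cramer k.+1 (fun i j => W j i) a.
pose M i := vdet k.+1 ((fun i j => W j i) \o bump i).
have ME i : M i = vdet k.+1 (fun j p => W j (bump i p)) by rewrite -vdet_tr.
move=> E.
have {}E : \sum_(i < k.+2) (sg * (-1) ^+ i * y i) * (ep * M i) = 0.
  rewrite -[RHS](mulr0 (sg * ep)) -[in RHS]E mulr_sumr; apply: eq_bigr => i _.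
  by rewrite -/(M i) -/(y i); ring.
have y0 p : (p < k.+2)%N -> y p = 0.
  move=> pk; have pos (i : 'I_k.+2) : true -> 0 <= (sg * (-1) ^+ i * y i) * (ep * M i).
    have ik : (i <= k.+1)%N by have := ltn_ord i.
    by move=> _; apply: mulr_ge0; [exact: alt | rewrite ME; apply/ltW/Wpos].
  move/eqP: E; rewrite psumr_eq0 // => /allP/(_ (Ordinal pk) (mem_index_enum _)) /=.
  have Mp : 0 < ep * M p by rewrite ME; exact: Wpos.
  by rewrite mulf_eq0 (gt_eqF Mp) orbF !mulf_eq0 (negPf sg0) signr_eq0 /= => /eqP.
have := Wpos k.+1 (leqnn _).
suff -> : vdet k.+1 (fun j p => W j (bump k.+1 p)) = 0 by rewrite mulr0 ltxx.
apply/eqP/det0P; exists (\row_(j < k.+1) a j).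
  by apply/eqP => /matrixP/(_ 0 (Ordinal j0k)); rewrite !mxE => /eqP; rewrite (negPf aj0).
apply/matrixP => i p; rewrite !mxE -[RHS](y0 p (leqW (ltn_ord p))).
apply: eq_bigr => j _; rewrite !mxE; congr (_ * W j _).
by rewrite bumpE leqNgt ltn_ord.
Qed.

(** On each of the [k + 1] intervals, [W] is the sum of the columns weighted by the
    absolute values of the input, and [a] is its sign there.  On an interval
    where the input vanishes, [W] is an arbitrary column and [a] is zero: this
    keeps the minors of [W] positive. *)
Lemma consistent_not_alternating u : hankel_dom g u -> u <> cst 0 ->
  ~ alternates k.+1 u -> ~ weakly_alternates k.+1 (hankel_op g u).
Proof.
move=> du u0 nalt [f [sg [sg0 fi alt]]].
have [|c [sgn [c0 ci sgn2 cP]]] := @sign_blocks u k 0%N.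
  move=> a w _ pw; rewrite leqNgt; apply/negP => kw; apply: nalt.
  exact: path_alternates pw kw.
pose x t p := s (f p + t)%N.
have uE j t : (j <= k)%N -> (c j <= t)%N -> ((j < k)%N -> (t < c j.+1)%N) ->
    u t = sgn j * `|u t|.
  move=> jk ct tc; have := cP j t jk ct tc => /ger0_norm.
  rewrite normrM (_ : `|sgn j| = 1); last first.
    by apply/eqP; rewrite -(@eqrXn2 _ 2) // ?expr1n -normrX ?sgn2 ?normr1.
  by rewrite mul1r => {1}->; rewrite mulrA -expr2 sgn2 mul1r.
pose B j t := (c j <= t < c j.+1)%N.
pose S j (z : nat -> R) := exists2 t, B j t & z = x t.
have [F FP] : exists F : nat -> (nat -> R) * R, forall j, (j < k)%N ->
    [/\ cone (S j) (F j).1,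
        forall p, \sum_(c j <= t < c j.+1) u t * x t p = (F j).2 * (F j).1 p &
        forall t, B j t -> u t != 0 -> (F j).2 != 0].
  apply: (@finite_choice _ (x 0%N, 0) k (fun j F => [/\ cone (S j) F.1,
        forall p, \sum_(c j <= t < c j.+1) u t * x t p = F.2 * F.1 p &
        forall t, B j t -> u t != 0 -> F.2 != 0])) => j jk.
  have cj : (c j < c j.+1)%N by apply: ci.
  have [[t0 [Bt0 ut0]]|no] := pselect (exists t, B j t /\ u t != 0); last first.
    have u00 t : B j t -> u t = 0.
      by move=> Bt; apply/eqP/negPn/negP => ut; apply: no; exists t.
    exists (x (c j), 0); split=> /=.
    - apply: (@cone_gen _ _ 1 (x (c j))) => // [|i]; rewrite ?mul1r //.
      by exists (c j); rewrite // /B leqnn.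
    - by move=> p; rewrite mul0r big_nat big1 // => t Bt; rewrite u00 ?mul0r.
    - by move=> t Bt ut; case: no; exists t.
  exists ((fun p => \sum_(c j <= t < c j.+1) `|u t| * x t p), sgn j); split=> /=.
  - apply: cone_sum => [t _|t Bt _|]; first exact: normr_ge0.
      by exists t.
    by exists t0; rewrite // normr_gt0.
  - move=> p; rewrite mulr_sumr; apply: eq_big_nat => t /andP[ct tc].
    by rewrite [in LHS](uE j t (ltnW jk) ct) // mulrA.
  - by move=> _ _ _; rewrite -sqrf_eq0 sgn2 oner_eq0.
pose y p := hankel_op g u (f p).
pose head p := \sum_(j < k) (F j).2 * (F j).1 p.
have headE p : \sum_(0 <= t < c k) u t * x t p = head p.
  rewrite -[0%N in LHS]c0 sum_blocks //; apply: eq_bigr => j _.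
  by have [_ -> _] := FP j (ltn_ord j).
have tailP p : \sum_(c k <= t < n) u t * x t p @[n --> \oo] --> y p - head p.
  have sE n : hankel_series g u (f p) n = \sum_(0 <= t < n) u t * x t p.
    by apply: eq_bigr => t _; rewrite mulrC addnS.
  have lim : hankel_series g u (f p) n @[n --> \oo] --> y p by exact: (du (f p)).
  have : hankel_series g u (f p) n - head p @[n --> \oo] --> y p - head p.
    by apply: cvgB => //; exact: cvg_cst.
  apply: cvg_near_eq; near=> n.
  rewrite sE -headE (@big_cat_nat _ _ _ (c k)) //=; first by rewrite addrAC subrr add0r.
  by near: n; exact: nbhs_infty_ge.
pose D0 := hminor s k.+1 id id.
pose V (Wk : nat -> R) j := if (j < k)%N then (F j).1 else Wk.
(* the last vector is here replaced by a single column [t] of the last interval *)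
have Vpos Wk i t : (i <= k.+1)%N -> (c k <= t)%N ->
    0 < D0 * vdet k.+1 (set_vec (fun j p => V Wk j (bump i p)) k (x t \o bump i)).
  move=> ik ct.
  pose S' j (z : nat -> R) := if (j < k)%N then exists2 w', S j w' & z = w' \o bump i
    else z = x t \o bump i.
  apply: (@cone_vdet_gt0 _ k.+1 D0 S') => [v vS|j jk]; last first.
    rewrite /set_vec /S' /V; case: eqP => [->|/eqP jk'].
      by rewrite ltnn; apply: (@cone_gen _ _ 1 (x t \o bump i)) => // p; rewrite mul1r.
    have -> : (j < k)%N by lia.
    by apply: cone_comp; have [] := FP j ltac:(lia).
  have [tau tauP] : exists tau : nat -> nat, forall j, (j < k.+1)%N ->
      v j = x (tau j) \o bump i /\ (if (j < k)%N then B j (tau j) else tau j == t).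
    apply: (@finite_choice nat 0%N k.+1 (fun j m => v j = x m \o bump i /\
      (if (j < k)%N then B j m else m == t))) => j jk.
    have := vS j jk; rewrite /S'; case: ifP => _.
      by move=> [w' [m Bm ->] ->]; exists m.
    by move=> ->; exists t.
  have taui : incr k.+1 tau.
    move=> j l jl lk; have [_] := tauP j ltac:(lia); have [_] := tauP l lk.
    have -> : (j < k)%N by lia.
    have cl : (c j.+1 <= c l)%N.
      by have := @incr_le _ c j.+1 l ci jl lk; lia.
    case: ifP => lk'; first by move=> /andP[a _] /andP[_ b]; lia.
    have -> : l = k by lia.
    move=> /eqP -> /andP[_ b].
    have : (c l <= c k)%N by have := @incr_le _ c l k ci ltac:(lia) ltac:(lia); lia.
    by lia.
  have -> : vdet k.+1 v = hminor s k.+1 (f \o bump i) tau.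
    by apply: eq_vdet => j p jk _; have [-> _] := tauP j jk.
  by apply: SC => //; apply: incr_bump.
(* the last interval is infinite, and its contribution is a limit *)
have [Wk [ak [WkP akP Wkpos]]] : exists (Wk : nat -> R) (ak : R),
   [/\ forall p, y p - head p = ak * Wk p,
       forall t, (c k <= t)%N -> u t != 0 -> ak != 0 &
       forall i, (i <= k.+1)%N ->
         0 < D0 * vdet k.+1 (set_vec (fun j p => V Wk j (bump i p)) k (Wk \o bump i))].
  have [[t0 [ct0 ut0]]|no] := pselect (exists t, (c k <= t)%N /\ u t != 0); last first.
    exists (x (c k)), 0; split=> [p|t ct ut|i ik]; last exact: Vpos.
      rewrite mul0r.
      suff : \sum_(c k <= t < n) u t * x t p @[n --> \oo] --> (0 : R).
        exact: (cvg_unique (@Rhausdorff R) (tailP p)).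
      apply: cvg_near_cst; apply: nearW => n.
      rewrite big_nat big1 // => t /andP[ct _].
      have [->|ut] := eqVneq (u t) 0; first by rewrite mul0r.
      by case: no; exists t.
    by case: no; exists t.
  exists (fun p => sgn k * (y p - head p)), (sgn k); split=> [p|_ _ _|i ik].
  - by rewrite mulrA -expr2 sgn2 mul1r.
  - by rewrite -sqrf_eq0 sgn2 oner_eq0.
  apply: (@vdet_tail_gt0 k _ (fun t => x t \o bump i) _
    (fun t => `|u t|) _ (c k) t0) => //.
  - by move=> t ct; apply: Vpos.
  - by rewrite normr_gt0.
  move=> p pk; have : sgn k * \sum_(c k <= t < n) u t * x t (bump i p) @[n --> \oo] -->
      sgn k * (y (bump i p) - head (bump i p)) by apply: cvgMl_tmp; exact: tailP.
  apply: cvg_near_eq; apply: nearW => n; rewrite mulr_sumr.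
  apply: eq_big_nat => t /andP[ct _]; rewrite mulrA /=; congr (_ * _).
  by rewrite {1}(uE k t) ?ltnn // mulrA -expr2 sgn2 mul1r.
pose W := V Wk; pose a j := if (j < k)%N then (F j).2 else ak.
have yE p : y p = \sum_(j < k.+1) a j * W j p.
  rewrite big_ord_recr /= /W /V /a ltnn -WkP addrC -addrA.
  rewrite (eq_bigr (fun j : 'I_k => (F j).2 * (F j).1 p)) ?addNr ?addr0 // => j _.
  by rewrite ltn_ord.
have an0 : exists2 j, (j < k.+1)%N & a j != 0.
  have [t ut] : exists t, u t != 0.
    apply: contrapT => no; apply: u0; apply/funext => t /=.
    by apply/eqP/negPn/negP => ut; apply: no; exists t.
  have [ct|tc] := leqP (c k) t.
    by exists k => //; rewrite /a ltnn; exact: akP ut.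
  have [j jk Bj] : exists2 j, (j < k)%N & B j t by apply: exists_block; rewrite c0.
  exists j; first exact: ltnW.
  by rewrite /a jk; have [_ _ /(_ t Bj ut)] := FP j jk.
apply: (@no_weak_alternation W a D0 sg _ an0 sg0) => [i ik|p pk].
  have := Wkpos i ik; congr (0 < _ * _); apply: eq_vdet => j p _ _.
  by rewrite /set_vec /W /V; case: eqP => // ->; rewrite ltnn.
by rewrite -yE; exact: alt.
Unshelve. all: by end_near. Qed.

End ConsistentToBounding.

(** * Equivalence of the three conditions *)

Theorem theorem1 (R : realType) (n k : nat) (A : 'M[R]_n) (b : 'cV[R]_n)
    (c : 'rV[R]_n) (hk : (1 <= k <= n)%N) :
  let g := impulse_response A b c in
  (strictly_variation_bounding k.-1 (hankel_dom g) (hankel_op g)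
     <-> hankel_op_strictly_sign_consistent k g) /\
  (hankel_op_strictly_sign_consistent k g
     <-> (forall r : nat, (1 <= r <= k)%N ->
            strictly_externally_positive (compound r A)
              (compound_sys_b A b k r) (compound_sys_c A b c k r))).
Proof.
move=> g; have /andP[k0 _] := hk.
have SC := hankel_op_strictly_sign_consistentP g k0.
have VB := strictly_variation_boundingP g k0.
split; last by rewrite SC; exact: sign_consistent_compound.
rewrite SC VB; split=> [|H u du u0 nalt]; first exact: bounding_all_minors.
case: k k0 {hk SC VB} H nalt => // k _ H nalt.
exact: consistent_not_alternating.
Qed.
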